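(* The space $\mathsf{UIHPQ}_0$ has the law of Kesten's tree $\mathcal{T}_\infty$ associated to the critical geometric probability distribution $(\mu_{1/2}(k),k\in\mathbb{N}_0)$ given by $\mu_{1/2}(k)=2^{-(k+1)}$.
   Context: Definition of $\mathsf{UIHPQ}_0$. Let $\mathsf b=(\mathsf b(i))_{i\in\mathbb Z}$ be a two-sided simple symmetric random walk with $\mathsf b(0)=0$. Call $i\in\mathbb Z$ a down-step if $\mathsf b(i+1)=\mathsf b(i)-1$. In the general construction of $\mathsf{UIHPQ}_p$ ($p\in[0,1/2]$), independent uniformly labeled Galton-Watson trees with offspring law $\mu_p(k)=p^k(1-p)$ are grafted on the down-steps of $\mathsf b$ in the upper half-plane (the line being $\mathbb Z$) with labels shifted by the value of $\mathsf b$ at the down-step, and each corner of the trees, taken in left-to-right contour order, is joined by an arc to its successor, i.e. the next corner with label smaller by one. For $p=0$ all trees are single vertices, so the construction reads as follows: the vertex set of $\mathsf{UIHPQ}_0$ is the set of down-steps of $\mathsf b$, the down-step $i$ having label $\mathsf b(i)$; for each down-step $i$ there is an edge (arc in the upper half-plane, drawn so that arcs do not cross) between $i$ and its successor, the smallest down-step $k>i$ with $\mathsf b(k)=\mathsf b(i)-1$. For $i\in\mathbb Z$ let $\varphi(i)$ be the smallest down-step $k\ge i$ with $\mathsf b(k)=\mathsf b(i)$. The root edge is the edge connecting $\varphi(0)$ to $\varphi(1)$, oriented from $\varphi(0)$ to $\varphi(1)$. The result is a random infinite rooted planar map. Kesten's tree associated to a critical offspring law $\nu$ with mean $1$: the random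 infinite plane tree with an infinite spine starting at the root, in which spine vertices have offspring law $\bar\nu(k)=k\nu(k)$, a uniformly chosen child of each spine vertex is the next spine vertex, all vertices off the spine have offspring law $\nu$, and all numbers of children are independent. It is viewed as a rooted planar map (rooted at the edge from the root to its first child). Equality in law is as random rooted planar maps with respect to the local topology, generated by $d_{\mathrm{map}}(\mathsf m,\mathsf m')=(1+\sup\{r\ge 0:\mathrm{Ball}_r(\mathsf m)=\mathrm{Ball}_r(\mathsf m')\})^{-1}$, where $\mathrm{Ball}_r$ is the submap spanned by the vertices at graph distance at most $r$ from the root vertex. *)

(* Defs.v *)
From HB Require Import structures.
From mathcomp Require Import all_boot all_order all_algebra.
From mathcomp Require Import finmap.
From mathcomp Require Import all_classical all_reals all_analysis.
Set Implicit Arguments.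
Unset Strict Implicit.
Unset Printing Implicit Defensive.
Import Order.TTheory GRing.Theory Num.Theory.
Local Open Scope classical_set_scope.
Local Open Scope ring_scope.

(** * Rooted planar maps *)

(* Combinatorial maps.  A dart is an oriented edge: [src x] is its origin,
   [rev x] the same edge with the opposite orientation, and [rot x] the next
   dart around [src x] in counterclockwise order.  The vertices and darts are
   those in [vset] and [dset]; what the functions do elsewhere is irrelevant. *)
Record premap : Type := Premap {
  vertex : Set;
  dart : Set;
  vset : set vertex;
  dset : set dart;
  src : dart -> vertex;
  rev : dart -> dart;
  rot : dart -> dart;
  root : dart }.
Arguments vset : clear implicits.
Arguments dset : clear implicits.

Definition tgt (m : premap) (x : dart m) : vertex m := src (rev x).
Definition root_vertex (m : premap) : vertex m := src (root m).

Fixpoint within (m : premap) (r : nat) : set (vertex m) :=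
  if r is r'.+1
  then @within m r' `|`
       [set tgt x | x in [set x | dset m x /\ @within m r' (src x)]]
  else [set root_vertex m].
Arguments within : clear implicits.

Definition first_return (T : Set) (A : set T) (f : T -> T) (x : T) : T :=
  xget (x : {classic T}) [set y | exists n, [/\ y = iter n.+1 f x, A y &
    forall k, (k < n)%N -> ~ A (iter k.+1 f x)]].

(* In the submap spanned by a set of vertices, turning around a vertex means
   turning around it in the original map and skipping the missing darts. *)
Definition ball (m : premap) (r : nat) : premap :=
  let D := [set x | [/\ dset m x, within m r (src x) & within m r (tgt x)]] in
  Premap (within m r) D (@src m) (@rev m) (first_return D (@rot m)) (root m).

Definition map_iso (m m' : premap) : Prop :=
  exists fv : vertex m -> vertex m', exists fd : dart m -> dart m',
    [/\ set_bij (vset m) (vset m') fv,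
        set_bij (dset m) (dset m') fd,
        forall x, dset m x -> [/\ src (fd x) = fv (src x),
          rev (fd x) = fd (rev x) & rot (fd x) = fd (rot x)]
      & fd (root m) = root m'].

Definition orbit_of (T : Type) (f : T -> T) (x : T) : set T :=
  [set iter n f x | n in [set: nat]].

Definition edges (m : premap) : set (set (dart m)) :=
  [set [set x; rev x] | x in dset m].
Arguments edges : clear implicits.

Definition faces (m : premap) : set (set (dart m)) :=
  [set orbit_of (fun y => rot (rev y)) x | x in dset m].
Arguments faces : clear implicits.

Definition euler_planar (m : premap) : Prop :=
  exists v e f : nat,
    [/\ (vset m #= `I_v)%card, (edges m #= `I_e)%card, (faces m #= `I_f)%card
      & (v + f = e + 2)%N].

(* [is_map_rot] says that the darts issued from a vertex form one finite cycle
   of [rot]; in particular every vertex has finite degree.  An infinite map is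
   planar when its finite submaps are; balls exhaust them by connectedness.
   The ball of radius 0 is skipped, since it may have no dart. *)
Record is_map (m : premap) : Prop := IsMap {
  is_map_src : forall x, dset m x -> vset m (src x);
  is_map_rev : forall x, dset m x ->
    [/\ dset m (rev x), rev (rev x) = x & rev x <> x];
  is_map_rot_closed : forall x, dset m x -> dset m (rot x);
  is_map_rot : forall x y, dset m x -> dset m y ->
    (src x = src y <-> exists n, iter n (@rot m) x = y);
  is_map_root : dset m (root m);
  is_map_connected : forall v, vset m v -> exists r, within m r v;
  is_map_planar : forall r, euler_planar (ball m r.+1) }.

Record rmap : Type := RMap { premap_of :> premap; rmapP : is_map premap_of }.

Definition edge_premap : premap :=
  @Premap bool bool [set: bool] [set: bool] id negb id true.

Lemma edge_premapP : is_map edge_premap.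
Proof.
have w r : within edge_premap r.+1 = [set: bool].
  apply/seteqP; split => // -[] _.
    by elim: r => [|r IH]; left => //; exact: IH.
  elim: r => [|r IH]; last by left; exact: IH.
  by right; exists true.
have bD r : dset (ball edge_premap r.+1) = [set: bool].
  by apply/seteqP; split => // x _; split; rewrite ?w.
split => //=.
- by case; split.
- move=> x y _ _; split => [->|[n <-]]; first by exists 0%N.
  by elim: n.
- by move=> v _; exists 1%N; rewrite w.
move=> r; exists 2%N, 1%N, 1%N; split => //.
- rewrite [vset _]w; apply/eq_cardSP; exists true => //.
  apply/eq_cardSP; exists false => //.
  rewrite II0 card_eq0; apply/eqP/seteqP; split => //.
  by move=> [] [[_ h1] h2]; [case: h1|case: h2].
- rewrite /edges bD (_ : [set _ | x in _] = [set [set: bool]]); first exact: card_set1.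
  apply/seteqP; split => [_ [x _ <-]|_ ->].
    by apply/seteqP; split => // y _; case: x y => [] []; by [left|right].
  exists true => //; by apply/seteqP; split => // -[] _; by [left|right].
- rewrite /faces bD (_ : [set _ | x in _] = [set [set: bool]]); first exact: card_set1.
  have step x : rot (rev x : dart (ball edge_premap r.+1)) = ~~ x.
    apply: (@xget_unique {classic bool}) => [|y [n [-> _ nn]]].
      by exists 0%N; split => //; rewrite -/(dset (ball edge_premap r.+1)) bD.
    case: n nn => // n /(_ 0%N erefl); rewrite -/(dset (ball edge_premap r.+1)) bD.
    by move=> /(_ I).
  have orb x : orbit_of (fun y : dart (ball edge_premap r.+1) => rot (rev y)) x
      = [set: bool].
    apply/seteqP; split => // y _.
    case: (eqVneq x y) => [->|xy]; first by exists 0%N.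
    exists 1%N => //; transitivity (~~ x); first exact: step.
    by case: x y xy => [] [].
  apply/seteqP; split => [_ [x _ <-]|_ ->]; first exact: orb.
  by exists true => //; exact: orb.
Qed.

Definition edge_map : rmap := RMap edge_premapP.

(* Used on random data, for which [is_map m] holds almost surely. *)
Definition to_rmap (m : premap) : rmap :=
  if pselect (is_map m) is left mP then RMap mP else edge_map.

(** * The local topology *)

HB.instance Definition _ := gen_eqMixin rmap.
HB.instance Definition _ := gen_choiceMixin rmap.
HB.instance Definition _ := isPointed.Build rmap edge_map.

(* A pseudometric: isomorphic maps are at distance 0, so that Borel sets are
   invariant under isomorphism and laws on [rmap] are laws of isomorphism
   classes.  The radius 0 is put by hand in the set of radii, that is, the
   supremum is 0 when no two balls coincide. *)
Definition dmap (R : realType) (m m' : rmap) : R :=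
  fine ((1 + ereal_sup [set (r%:R : R)%:E | r in
    [set r | r = 0%N \/ map_iso (ball m r) (ball m' r)]])^-1)%E.

Definition dmap_open (R : realType) : set (set rmap) :=
  [set A | forall m, A m -> exists2 e : R, 0 < e &
    forall m', dmap R m m' < e -> A m'].

(* [rmap] with the Borel sigma-algebra of the local topology. *)
Definition map_space (R : realType) := g_sigma_algebraType (@dmap_open R).

(** * Independence of discrete random variables *)

Definition discrete_rv (d : measure_display) (Omega : measurableType d)
    (T : Type) (X : Omega -> T) : Prop :=
  forall B : set T, measurable (X @^-1` B).

Definition events_of (Omega T : Type) (X : Omega -> T) : set (set Omega) :=
  [set X @^-1` B | B in [set: set T]].

Definition mutually_independent (d : measure_display) (Omega : measurableType d)
    (R : realType) (P : probability Omega R) (I : choiceType)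
    (F : I -> set (set Omega)) : Prop :=
  forall (J : {fset I}) (A : I -> set Omega),
    (forall i, i \in J -> F i (A i)) ->
    P (\bigcap_(i in [set` J]) A i) = (\prod_(i <- J) P (A i))%E.

(** * The map coded by a two-sided walk *)

Definition two_sided_srw (d : measure_display) (Omega : measurableType d)
    (R : realType) (P : probability Omega R) (b : int -> Omega -> int) : Prop :=
  let step i w := b (i + 1) w - b i w in
  [/\ forall w, b 0 w = 0,
      forall i, discrete_rv (b i),
      forall i, P (step i @^-1` [set 1]) = (2^-1)%:E /\
                P (step i @^-1` [set -1]) = (2^-1)%:E
    & mutually_independent P (fun i => events_of (step i))].

Definition least (A : set int) : int := xget 0 [set k | A k /\ lbound A k].

Section Uihpq0.
Variable b : int -> int.

Definition downstep (i : int) : bool := b (i + 1) == b i - 1.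

Definition successor (i : int) : int :=
  least [set k | [/\ downstep k, i < k & b k = b i - 1]].

Definition phi (i : int) : int :=
  least [set k | [/\ downstep k, i <= k & b k = b i]].

Definition predecessors (i : int) : set int :=
  [set j | downstep j /\ successor j = i].

Definition arc_src (x : int * bool) : int := if x.2 then x.1 else successor x.1.

Definition arc_rev (x : int * bool) : int * bool := (x.1, ~~ x.2).

(* [(i, true)] is the arc from [i] to its successor, oriented that way, and
   [(i, false)] the same arc oriented backwards.  Counterclockwise around a
   vertex of the line, an upper half-plane drawing without crossings shows
   first the only arc going to the right, and then the arcs going to the left,
   from the widest (whose other end is leftmost) to the narrowest. *)
Definition arc_rot (x : int * bool) : int * bool :=
  let v := arc_src x in
  let S := if x.2 then predecessors v
           else predecessors v `&` [set k | x.1 < k] in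
  if `[< S !=set0 >] then (least S, false) else (v, true).

(* For the simple random walk, exactly one dart satisfies this almost surely. *)
Definition arc_root : int * bool :=
  xget (0, true) [set x | [/\ downstep x.1, arc_src x = phi 0
                            & arc_src (arc_rev x) = phi 1]].

Definition uihpq0_premap : premap :=
  Premap [set i | downstep i] [set x | downstep x.1]
    arc_src arc_rev arc_rot arc_root.

(* An almost sure property of the simple random walk, under which successors
   and [phi] exist, vertices have finite degree, and the map is connected. *)
Definition oscillating : Prop :=
  (forall i, b (i + 1) = b i + 1 \/ b (i + 1) = b i - 1) /\
  (forall i n, (exists2 k, i <= k & b k <= n) /\
               (exists2 k, k <= i & b k <= n)).

Definition uihpq0 : rmap :=
  if `[< oscillating >] then to_rmap uihpq0_premap else edge_map.

End Uihpq0.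

(** * Kesten's tree *)

Section Plane_tree.

(* Vertices are words of child ranks (starting from 0), with the last rank at
   the head: [j :: u] is the [j]-th child of [u], and [k u] is the number of
   children of [u]. *)
Variable k : seq nat -> nat.

Fixpoint in_tree (u : seq nat) : bool :=
  if u is j :: v then (j < k v)%N && in_tree v else true.

(* For [u] other than the root, [(u, true)] is the edge from [u] to its parent
   and [(u, false)] the edge from its parent to [u]. *)
Definition tree_src (x : seq nat * bool) : seq nat :=
  if x.2 then x.1 else behead x.1.

Definition tree_rev (x : seq nat * bool) : seq nat * bool := (x.1, ~~ x.2).

(* The children of a vertex are drawn above it, from left to right, so that the
   counterclockwise order is: parent, last child, ..., first child. *)
Definition tree_rot (x : seq nat * bool) : seq nat * bool :=
  match x with
  | (u, true) => if k u is j.+1 then (j :: u, false) else (u, true)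
  | (j.+1 :: u, false) => (j :: u, false)
  | (0%N :: [::], false) => ([:: (k [::]).-1], false)
  | (0%N :: u, false) => (u, true)
  | ([::], false) => ([::], false)
  end.

Definition tree_premap : premap :=
  Premap [set u | in_tree u] [set x | in_tree x.1 && (x.1 != [::])]
    tree_src tree_rev tree_rot ([:: 0%N], false).

End Plane_tree.

Definition mu_half (R : realType) (k : nat) : R := (2 ^+ k.+1)^-1.

Definition size_biased (R : realType) (nu : nat -> R) (k : nat) : R :=
  k%:R * nu k.

(* [X u] is the number of children of [u] if [u] is not on the spine; [S n]
   is the pair of the number of children of the spine vertex of height [n] and
   of the rank of the child of it that is the next spine vertex. *)
Record kesten_variables (d : measure_display) (Omega : measurableType d)
    (R : realType) (P : probability Omega R) (nu : nat -> R)
    (X : seq nat -> Omega -> nat) (S : nat -> Omega -> nat * nat) : Prop :=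
  KestenVariables {
  kesten_X_rv : forall u, discrete_rv (X u);
  kesten_S_rv : forall n, discrete_rv (S n);
  kesten_X_law : forall u k, P (X u @^-1` [set k]) = (nu k)%:E;
  kesten_S_law : forall n k j, P (S n @^-1` [set (k, j)]) =
    (if (j < k)%N then size_biased nu k / k%:R else 0)%:E;
  kesten_indep : mutually_independent P (fun i : seq nat + nat =>
    match i with inl u => events_of (X u) | inr n => events_of (S n) end) }.

Fixpoint spine (c : nat -> nat) (n : nat) : seq nat :=
  if n is n'.+1 then c n' :: spine c n' else [::].

Definition kesten_offspring (x : seq nat -> nat) (s : nat -> nat * nat)
    (u : seq nat) : nat :=
  if u == spine (fun n => (s n).2) (size u) then (s (size u)).1 else x u.

Definition kesten_tree (x : seq nat -> nat) (s : nat -> nat * nat) : rmap :=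
  to_rmap (tree_premap (kesten_offspring x s)).

(* Main.v *)
Require Import Defs.
From mathcomp Require Import all_boot all_order all_algebra.
From mathcomp Require Import finmap.
From mathcomp Require Import all_classical all_reals all_analysis.
From HB Require Import structures.
From mathcomp Require Import zify ring lra.
(* Again, so that [rev], [rot] and [root] are those of maps. *)
Require Import Defs.
Set Implicit Arguments.
Unset Strict Implicit.
Unset Printing Implicit Defensive.
Import Order.TTheory GRing.Theory Num.Theory.
Import numFieldNormedType.Exports.
Local Open Scope classical_set_scope.
Local Open Scope ring_scope.

(** Let [b] be an oscillating walk.  Every down-step has one arc to the right,
    ending at its successor, and finitely many arcs to the left.  Successors
    strictly increase, and any two down-steps have a common iterated successor,
    so the map is a tree with one end.  Exploring it clockwise from the root
    edge identifies it with the plane tree whose numbers of children are given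
    by [walk_tree b] ([uihpq0_iso]); in particular it is a planar map, because
    plane trees are ([tree_is_map], [is_map_iso]).

    It remains to compare two random plane trees.  The ball of radius [r] of a
    plane tree is determined by the numbers of children at height less than
    [r], so it is enough to compare the probabilities of properties of these
    numbers.  Let [v_0, v_1, ...] be the root vertex and its iterated
    successors, which play the role of the spine.  The descendants of
    [v_(r-1)] form a finite tree, with [N] vertices say, marked by the path
    from [v_0] to [v_(r-1)].  A [config] records such a finite part of a tree.
    In the walk, the descendants of [v_(r-1)] occupy an interval of [2 N] times
    around 0, on which all the steps are prescribed, with probability
    [2^(-2 N)] ([walk_match_le]).  In Kesten's tree, the same configuration
    prescribes the numbers of children of [N] vertices, and at the [r] vertices
    of the spine the rank of the next spine vertex.  Size-biasing gives [k]
    children and a given rank the probability [k mu(k) / k = mu(k)], where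
    [mu(k) = 2^(-k-1)], as for a vertex with [k] children off the spine.  The
    [N] vertices have [N] children altogether, since [v_r] makes up for the
    root vertex, so the sum of the exponents [k + 1] is again [2 N]
    ([kesten_match_ge]).

    The walk oscillates almost surely ([walk_osc_as]) and then has a
    configuration of each height ([walk_match_ex]), whereas the variables of
    Kesten's tree match at most one configuration of a given height
    ([var_match_uniq]).  Summing over configurations, a property of the levels
    below [r] is at most as likely for the walk as for Kesten's tree
    ([law_le]).  The same holds for the opposite property, so the two
    probabilities are equal ([law_eq]).  Finally, an open set of maps is an
    increasing union of such properties ([open_ball_core]), and the open sets
    are stable under intersection and generate the sigma-algebra. *)

(** * Isomorphisms of maps *)

Lemma set_bij_inv (T U : Type) (A : set T) (B : set U) (f : T -> U) (x0 : T) :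
  set_bij A B f ->
  exists g : U -> T, [/\ set_bij B A g, forall x, A x -> g (f x) = x
    & forall y, B y -> f (g y) = y].
Proof.
move=> [fAB fi fs].
pose g (y : U) : T := xget (x0 : {classic T}) [set x | A x /\ f x = y].
have gP y : B y -> A (g y) /\ f (g y) = y.
  by move=> /fs[x Ax fx]; apply: (@xgetPex {classic T} x0 [set x | A x /\ f x = y]); exists x.
have gK x : A x -> g (f x) = x.
  move=> Ax; have [Ag fg] := gP _ (fAB _ Ax).
  by apply: fi; rewrite ?inE.
exists g; split=> //; last by move=> y /gP[].
split=> [y By|y y' /set_mem By /set_mem By' e|x Ax].
- by have [] := gP _ By.
- by rewrite -(gP _ By).2 -(gP _ By').2 e.
- by exists (f x); [exact: fAB _ Ax|exact: gK].
Qed.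

Lemma first_return_eq (T : Set) (A : set T) (f : T -> T) x n :
  A (iter n.+1 f x) -> (forall k, (k < n)%N -> ~ A (iter k.+1 f x)) ->
  first_return A f x = iter n.+1 f x.
Proof.
move=> An nA; apply: (@xget_unique {classic T}); first by exists n; split.
move=> y [m [-> Am nAm]]; case: (ltngtP m n) => [mn|nm|->//].
  by case: (nA _ mn).
by case: (nAm _ nm).
Qed.

Lemma first_return_none (T : Set) (A : set T) (f : T -> T) x :
  (forall n, ~ A (iter n.+1 f x)) -> first_return A f x = x.
Proof.
move=> nA; apply: (@xgetPN {classic T}) => y [n [-> An _]]; exact: (nA n).
Qed.

(** On such maps isomorphisms can be inverted: an isomorphism only commutes
    with [rev] and [rot] on the darts of the map, which must therefore be
    stable under them. A ball of radius 0 may fail this, having no dart. *)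
Record dclosed (m : premap) : Prop := DClosed {
  dclosed_src : forall x, dset m x -> vset m (src x);
  dclosed_rev : forall x, dset m x -> dset m (rev x);
  dclosed_rot : forall x, dset m x -> dset m (rot x);
  dclosed_root : dset m (root m) }.

Lemma is_map_dclosed m : is_map m -> dclosed m.
Proof.
by case=> h1 h2 h3 h4 h5 _ _; split=> // x /h2[].
Qed.

Lemma iter_rot_dset m x n : dclosed m -> dset m x -> dset m (iter n (@rot m) x).
Proof. by move=> mc mx; elim: n => //= n; apply: dclosed_rot. Qed.

Lemma map_iso_sym m m' : dclosed m -> map_iso m m' -> map_iso m' m.
Proof.
move=> mc [fv [fd [fvb fdb fP fr]]].
have [gv [gvb gvK fgv]] := set_bij_inv (root_vertex m) fvb.
have [gd [gdb gdK fgd]] := set_bij_inv (root m) fdb.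
exists gv, gd; split=> //; last by rewrite -fr gdK//; exact: dclosed_root.
move=> y my; have mx : dset m (gd y) by case: gdb => /(_ _ my).
have [] := fP _ mx; rewrite fgd// => -> -> ->.
split; first by rewrite gvK//; exact: dclosed_src.
  by rewrite gdK//; exact: dclosed_rev.
by rewrite gdK//; exact: dclosed_rot.
Qed.

Lemma set_bij_comp_fun (T U V : Type) (A : set T) (B : set U) (C : set V)
  (f : T -> U) (g : U -> V) :
  set_bij A B f -> set_bij B C g -> set_bij A C (fun x => g (f x)).
Proof.
move=> [fAB fi fs] [gBC gi gs]; split.
- by move=> x Ax; apply: gBC; exact: fAB.
- move=> x y /[dup] /set_mem Ax xA /[dup] /set_mem Ay yA e; apply: fi => //.
  by apply: gi => //; rewrite inE; apply: fAB.
- by move=> z /gs[y /fs[x Ax <-] <-]; exists x.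
Qed.

Lemma map_iso_trans m m' m'' : map_iso m m' -> map_iso m' m'' -> map_iso m m''.
Proof.
move=> [fv [fd [fvb fdb fP fr]]] [gv [gd [gvb gdb gP gr]]].
exists (fun x => gv (fv x)), (fun x => gd (fd x)); split.
- exact: set_bij_comp_fun gvb.
- exact: set_bij_comp_fun gdb.
- move=> x mx; have mfx : dset m' (fd x) by case: fdb => /(_ _ mx).
  have [-> -> ->] := gP _ mfx; have [-> -> ->] := fP _ mx; by [].
- by rewrite fr.
Qed.

Lemma within_vset m r : dclosed m -> within m r `<=` vset m.
Proof.
move=> mc; elim: r => [_ ->|r IH v [/IH//|[x [mx _] <-]]].
  exact/(dclosed_src mc)/(dclosed_root mc).
exact/(dclosed_src mc)/(dclosed_rev mc).
Qed.

Section IsoTransport.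
Variables (m m' : premap) (fv : vertex m -> vertex m') (fd : dart m -> dart m').
Hypothesis mc : dclosed m.
Hypothesis fvb : set_bij (vset m) (vset m') fv.
Hypothesis fdb : set_bij (dset m) (dset m') fd.
Hypothesis fP : forall x, dset m x -> [/\ src (fd x) = fv (src x),
          rev (fd x) = fd (rev x) & rot (fd x) = fd (rot x)].
Hypothesis fr : fd (root m) = root m'.

Let fdi x y : dset m x -> dset m y -> fd x = fd y -> x = y.
Proof. by move=> mx my; case: fdb => _ fi _; apply: fi; rewrite inE. Qed.

Let fvi x y : vset m x -> vset m y -> fv x = fv y -> x = y.
Proof. by move=> mx my; case: fvb => _ fi _; apply: fi; rewrite inE. Qed.

Let fd_in x : dset m x -> dset m' (fd x).
Proof. by move=> mx; case: fdb => /(_ _ mx). Qed.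

Let fv_in x : vset m x -> vset m' (fv x).
Proof. by move=> mx; case: fvb => /(_ _ mx). Qed.

Let fd_sur y : dset m' y -> exists2 x, dset m x & fd x = y.
Proof. by case: fdb => _ _ /[apply] -[x mx <-]; exists x. Qed.

Let fv_sur y : vset m' y -> exists2 x, vset m x & fv x = y.
Proof. by case: fvb => _ _ /[apply] -[x mx <-]; exists x. Qed.

Let tgt_iso x : dset m x -> tgt (fd x) = fv (tgt x).
Proof.
move=> mx; rewrite /tgt; have [_ -> _] := fP mx.
by have [-> _ _] := fP (dclosed_rev mc mx).
Qed.

Let iter_iso n x : dset m x -> iter n (@rot m') (fd x) = fd (iter n (@rot m) x).
Proof.
by move=> mx; elim: n => //= n ->; have [_ _ ->] := fP (iter_rot_dset n mc mx).
Qed.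

Lemma dclosed_iso : dclosed m'.
Proof.
split.
- move=> _ /fd_sur[x mx <-]; have [-> _ _] := fP mx.
  by apply: fv_in; exact: dclosed_src.
- move=> _ /fd_sur[x mx <-]; have [_ -> _] := fP mx.
  by apply: fd_in; exact: dclosed_rev.
- move=> _ /fd_sur[x mx <-]; have [_ _ ->] := fP mx.
  by apply: fd_in; exact: dclosed_rot.
- by rewrite -fr; apply: fd_in; exact: dclosed_root.
Qed.

Lemma within_iso r v : vset m v -> within m' r (fv v) <-> within m r v.
Proof.
elim: r v => [|r IH] v mv /=.
  have -> : root_vertex m' = fv (root_vertex m).
    by rewrite /root_vertex -fr; have [-> _ _] := fP (dclosed_root mc).
  split=> [/fvi|-> //]; apply=> //; exact/(dclosed_src mc)/(dclosed_root mc).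
split=> -[h|[y [my yr]]].
- by left; apply/IH.
- have [x mx e] := fd_sur my; subst y.
  rewrite tgt_iso// => /fvi e; right; exists x.
    split=> //; apply/IH; first exact: dclosed_src.
    by have [<- _ _] := fP mx.
  by apply: e => //; apply: (dclosed_src mc); exact: dclosed_rev.
- by left; apply/IH.
- move=> <-; right; exists (fd y); last exact: tgt_iso.
  split; first exact: fd_in.
  by have [-> _ _] := fP my; apply/IH => //; exact: dclosed_src.
Qed.

Let bD r x : dset m x -> dset (ball m' r) (fd x) <-> dset (ball m r) x.
Proof.
move=> mx; have [sx _ _] := fP mx; rewrite /= sx tgt_iso//.
have ms := dclosed_src mc mx; have mt := dclosed_src mc (dclosed_rev mc mx).
split=> -[_ /(within_iso _ ms) h1 /(within_iso _ mt) h2]; split=> //.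
exact: fd_in.
Qed.

Let first_return_iso r x : dset (ball m r) x ->
  first_return (dset (ball m' r)) (@rot m') (fd x) =
  fd (first_return (dset (ball m r)) (@rot m) x).
Proof.
move=> [mx _ _].
have key n : dset (ball m' r) (iter n (@rot m') (fd x)) <->
             dset (ball m r) (iter n (@rot m) x).
  by rewrite iter_iso//; apply: bD; exact: iter_rot_dset.
case: (pselect (exists n, dset (ball m r) (iter n.+1 (@rot m) x))) => [h|h].
  have [n /asboolP hn nmin] := @ex_minnP (fun n => `[< dset (ball m r) (iter n.+1 (@rot m) x) >])
    (let: ex_intro n hn := h in ex_intro _ n (introT (asboolP _) hn)).
  have e : first_return (dset (ball m r)) (@rot m) x = iter n.+1 (@rot m) x.
    apply: first_return_eq => // k kn hk.
    by move/asboolP: hk => /nmin; rewrite leqNgt kn.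
  rewrite e -iter_iso//; apply: first_return_eq => [|k kn hk].
    exact: (key n.+1).2.
  by move/(key k.+1): hk => /asboolP /nmin; rewrite leqNgt kn.
rewrite !first_return_none // => n hn; first by apply: h; exists n.
by apply: h; exists n; exact: (key n.+1).1.
Qed.

(** The rotation in a ball skips the missing darts. An isomorphism preserves
    distances to the root, hence which darts are missing, so it commutes with
    this skipping. *)
Lemma ball_iso_fun r :
  [/\ set_bij (vset (ball m r)) (vset (ball m' r)) fv,
        set_bij (dset (ball m r)) (dset (ball m' r)) fd,
        forall x : dart (ball m r), dset (ball m r) x ->
         [/\ src (fd x : dart (ball m' r)) = fv (src x),
          rev (fd x : dart (ball m' r)) = fd (rev x) &
          rot (fd x : dart (ball m' r)) = fd (rot x)]
      & fd (root (ball m r)) = root (ball m' r)].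
Proof.
split=> //.
- split.
  + by move=> v h; apply/within_iso => //; exact: within_vset mc _ h.
  + move=> x y /set_mem /(within_vset mc) mx /set_mem /(within_vset mc) my; exact: fvi.
  + move=> y h.
    have [x mx e] : exists2 x, vset m x & fv x = y.
      by apply: fv_sur; exact: within_vset dclosed_iso _ h.
    by exists x => //; apply/within_iso => //; rewrite e.
- split.
  + by move=> x [mx h1 h2]; apply/bD.
  + by move=> x y /set_mem [mx _ _] /set_mem [my _ _]; exact: fdi.
  + move=> y [my h1 h2]; have [x mx e] := fd_sur my; subst y.
    by exists x => //; apply/bD.
- move=> x xD; have [mx _ _] := xD; have [e1 e2 _] := fP mx; split=> //.
  exact: first_return_iso.
Qed.

End IsoTransport.

Lemma ball_iso m m' r : dclosed m -> map_iso m m' -> map_iso (ball m r) (ball m' r).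
Proof.
move=> mc [fv [fd [h1 h2 h3 h4]]]; exists fv, fd; exact: ball_iso_fun.
Qed.

(** Edges and faces are sets of darts, and an injection on darts induces an
    injection on sets of darts. *)
Lemma card_image_sub (T U : Type) (A : set (set T)) (D : set T) (f : T -> U) :
  set_inj D f -> (forall X, A X -> X `<=` D) ->
  ((fun X => f @` X) @` A #= A)%card.
Proof.
move=> fi AD; apply: inj_card_eq => X Y /set_mem AX /set_mem AY e.
have aux X' Y' : A X' -> A Y' -> f @` X' = f @` Y' -> X' `<=` Y'.
  move=> AX' AY' e' x Xx; have : (f @` Y') (f x) by rewrite -e'; exists x.
  case=> y Yy /fi; rewrite !inE => <- //; [exact: AD Yy|exact: AD Xx].
by apply/seteqP; split; apply: aux.
Qed.

Lemma euler_planar_iso m m' : dclosed m -> map_iso m m' ->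
  euler_planar m -> euler_planar m'.
Proof.
move=> mc [fv [fd [fvb fdb fP fr]]] [v [e [f [hv he hf hvef]]]].
have fdi : set_inj (dset m) fd by case: fdb.
have fdD : fd @` dset m = dset m'.
  by case: fdb => h1 _ h2; apply/seteqP; split=> // _ [x mx <-]; exact: h1.
exists v, e, f; split=> //.
- apply: card_eq_trans hv; case: fvb => h1 fvi h2.
  have -> : vset m' = fv @` vset m.
    by apply/seteqP; split=> // _ [x mx <-]; exact: h1.
  exact: inj_card_eq.
- apply: card_eq_trans he.
  have -> : edges m' = (fun X => fd @` X) @` edges m.
    rewrite /edges -fdD; apply/seteqP; split.
      move=> _ [_ [x mx <-] <-]; exists [set x; rev x]; first by exists x.
      by rewrite image_setU !image_set1; have [_ -> _] := fP _ mx.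
    move=> _ [_ [x mx <-] <-]; exists (fd x); first by exists x.
    by rewrite image_setU !image_set1; have [_ -> _] := fP _ mx.
  apply: (card_image_sub fdi) => _ [x mx <-] y [->|->] //; exact: dclosed_rev.
- apply: card_eq_trans hf.
  have fD x : dset m x -> dset m (rot (rev x)).
    by move=> mx; apply: dclosed_rot => //; exact: dclosed_rev.
  have itD n x : dset m x -> dset m (iter n (fun y => rot (rev y)) x).
    by move=> mx; elim: n => //= n; exact: fD.
  have itE n x : dset m x -> iter n (fun y => rot (rev y)) (fd x) =
      fd (iter n (fun y => rot (rev y)) x).
    move=> mx; elim: n => //= n ->; have [_ -> _] := fP _ (itD n x mx).
    by have [_ _ ->] := fP _ (dclosed_rev mc (itD n x mx)).
  have oE x : dset m x -> orbit_of (fun y => rot (rev y)) (fd x) =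
      fd @` orbit_of (fun y => rot (rev y)) x.
    move=> mx; apply/seteqP; split=> [_ [n _ <-]|_ [_ [n _ <-] <-]].
      by rewrite itE//; exists (iter n (fun y => rot (rev y)) x) => //; exists n.
    by exists n => //; rewrite itE.
  have -> : faces m' = (fun X => fd @` X) @` faces m.
    rewrite /faces -fdD; apply/seteqP; split.
      move=> _ [_ [x mx <-] <-]; rewrite oE//; exists (orbit_of (fun y => rot (rev y)) x) => //.
      by exists x.
    move=> _ [_ [x mx <-] <-]; rewrite -oE//; exists (fd x) => //.
  apply: (card_image_sub fdi) => _ [x mx <-] _ [n _ <-]; exact: itD.
Qed.

Lemma dclosed_ball m r : is_map m -> dclosed (ball m r.+1).
Proof.
move=> mP; have mc := is_map_dclosed mP; split.
- by move=> x [].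
- move=> x [mx h1 h2]; have [_ e _] := is_map_rev mP mx.
  split=> //; first exact: dclosed_rev.
  by rewrite /tgt e.
- move=> x xD /=; rewrite /first_return.
  by case: xgetP => [y -> [n [-> //]]|].
- split=> /=; first exact: dclosed_root.
    have h k : within m k (root_vertex m).
      by elim: k => [//|k IH]; left.
    exact: (h r.+1).
  right; exists (root m) => //; split; first exact: dclosed_root.
  by elim: r => [//|r IH]; left.
Qed.

Lemma is_map_iso m m' : is_map m -> map_iso m m' -> is_map m'.
Proof.
move=> mP iso; have mc := is_map_dclosed mP.
have [fv [fd [fvb fdb fP fr]]] := iso.
have mc' := dclosed_iso mc fvb fdb fP fr.
have fdi x y : dset m x -> dset m y -> fd x = fd y -> x = y.
  by move=> mx my; case: fdb => _ fi _; apply: fi; rewrite inE.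
have fvi x y : vset m x -> vset m y -> fv x = fv y -> x = y.
  by move=> mx my; case: fvb => _ fi _; apply: fi; rewrite inE.
have fd_sur y : dset m' y -> exists2 x, dset m x & fd x = y.
  by case: fdb => _ _ /[apply] -[x mx <-]; exists x.
split.
- exact: dclosed_src.
- move=> y my; split; first exact: dclosed_rev.
    have [x mx <-] := fd_sur _ my; have [rx rrx _] := is_map_rev mP mx.
    by have [_ -> _] := fP _ mx; have [_ -> _] := fP _ rx; rewrite rrx.
  have [x mx <-] := fd_sur _ my; have [rx rrx nrx] := is_map_rev mP mx.
  by have [_ -> _] := fP _ mx => /fdi; apply: contra_not nrx; exact.
- exact: dclosed_rot.
- move=> _ _ /fd_sur[x mx <-] /fd_sur[y my <-].
  have [-> _ _] := fP _ mx; have [-> _ _] := fP _ my.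
  have itE n : iter n (@rot m') (fd x) = fd (iter n (@rot m) x).
    by elim: n => //= n ->; have [_ _ ->] := fP _ (iter_rot_dset n mc mx).
  split=> [/fvi|[n]].
    move=> /(_ (dclosed_src mc mx) (dclosed_src mc my)).
    by move=> /(is_map_rot mP mx my)[n <-]; exists n.
  rewrite itE => /fdi => /(_ (iter_rot_dset n mc mx) my) e.
  by congr fv; apply/(is_map_rot mP mx my); exists n.
- exact: dclosed_root.
- move=> y; have [_ _ fs] := fvb => /fs[x mx <-].
  have [r xr] := is_map_connected mP mx; exists r.
  by apply/(within_iso mc fvb fdb fP fr).
- move=> r; apply: (euler_planar_iso _ (ball_iso r.+1 mc iso)).
    exact: dclosed_ball.
  exact: is_map_planar.
Qed.

Lemma dmap_lt (R : realType) (m m' : rmap) (e : R) r :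
  map_iso (ball m r) (ball m' r) -> (1 + r%:R)^-1 < e -> dmap R m m' < e.
Proof.
move=> iso; apply: le_lt_trans; rewrite /dmap.
set s := ereal_sup _.
have rs : ((r%:R : R)%:E <= s)%E by apply: ereal_sup_ubound; exists r => //; right.
case: s rs => [s| |] //; rewrite ?lee_fin => rs.
  have s0 : 0 < 1 + s by rewrite ltr_wpDr// (le_trans _ rs).
  rewrite -EFinD inver gt_eqF//= lef_pV2 ?posrE ?lerD2l //.
by rewrite addey// invey /= invr_ge0 addr_ge0.
Qed.

Lemma small_radius (R : realType) (e : R) : 0 < e ->
  exists r : nat, (1 + r.+1%:R)^-1 < e.
Proof.
move=> e0; exists (Num.truncn e^-1).
have r0 : 0 < 1 + (Num.truncn e^-1).+1%:R :> R by rewrite ltr_wpDr.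
rewrite invf_plt ?posrE//; apply: lt_le_trans (truncnS_gt _) _.
by rewrite lerDr.
Qed.

(** Isomorphic maps have isomorphic balls of every radius, so they are at
    distance 0 and no open set separates them. *)
Lemma dmap_open_iso (R : realType) (A : set rmap) (m m' : rmap) :
  dmap_open R A -> map_iso m m' -> A m -> A m'.
Proof.
move=> Ao iso /Ao[e e0]; apply; have [r re] := small_radius e0.
by apply: dmap_lt re; apply: ball_iso => //; apply: is_map_dclosed; exact: rmapP.
Qed.

(** * Plane trees as maps *)

Definition reach (T : Type) (f : T -> T) (x y : T) := exists n, iter n f x = y.

Lemma reach_refl T (f : T -> T) x : reach f x x.
Proof. by exists 0%N. Qed.

Lemma reach_step T (f : T -> T) x y : reach f (f x) y -> reach f x y.
Proof. by move=> [n <-]; exists n.+1; rewrite iterSr. Qed.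

Lemma reach_trans T (f : T -> T) x y z : reach f x y -> reach f y z -> reach f x z.
Proof. by move=> [n <-] [m <-]; exists (m + n)%N; rewrite iterD. Qed.

Section Tree.
Variable k : seq nat -> nat.
Let t := tree_premap k.

Lemma tree_dsetE (x : dart t) : dset t x <-> in_tree k x.1 /\ x.1 <> [::].
Proof.
by rewrite /=; split=> [/andP[? /eqP]|[-> /eqP]].
Qed.

(** The pattern matching in [tree_rot] inspects the word before the
    orientation, so that this does not hold by computation for a variable
    [u]. *)
Lemma tree_rot_up u :
  tree_rot k (u, true) = if k u is j.+1 then (j :: u, false) else (u, true).
Proof. by case: u => [|[|j] [|i u]]. Qed.

Lemma tree_dclosed : (0 < k [::])%N -> dclosed t.
Proof.
move=> k0; split.
- by move=> [[|j u] []] //= /andP[]// /andP[].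
- by move=> [u []].
- move=> [u b] /=; case: u => [|j u]; first by rewrite andbF.
  move=> /andP[/= /andP[ju ut] _]; case: b.
    rewrite -[X in in_tree k X.1 && (X.1 != _)]/(tree_rot k (j :: u, true)).
    rewrite tree_rot_up; case e : (k (j :: u)) => [|i]; first by rewrite /= ju ut.
    by rewrite /= e ltnSn ju ut.
  case: j ju => [|j] ju /=; last by rewrite (ltnW ju) ut.
  case: u ju ut => [|i u] ju ut /=; first by rewrite prednK // leqnn.
  by move: ut => /= /andP[-> ->].
- by rewrite /= k0.
Qed.

Lemma tree_rot_src (x : dart t) : dset t x -> src (rot x) = src x.
Proof.
case: x => [[|j u] b] //; case: b => _; last by case: j => [|j] //; case: u.
rewrite -[rot _]/(tree_rot k (j :: u, true)) tree_rot_up.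
by case: (k (j :: u)).
Qed.

Lemma tree_iter_down i j u : (i <= j)%N ->
  iter i (tree_rot k) (j :: u, false) = (j - i :: u, false)%N.
Proof.
elim: i => [|i IH] ij; first by rewrite subn0.
rewrite iterS IH ?(ltnW ij)//; have : (0 < j - i)%N by rewrite subn_gt0.
by rewrite subnS; case: (j - i)%N.
Qed.

Lemma tree_iter_up i u : (i < k u)%N ->
  iter i.+1 (tree_rot k) (u, true) = ((k u).-1 - i :: u, false)%N.
Proof.
move=> iu; rewrite iterSr.
have -> : tree_rot k (u, true) = ((k u).-1 :: u, false) by rewrite tree_rot_up; case: (k u) iu.
by rewrite tree_iter_down//; case: (k u) iu.
Qed.

Lemma tree_iter_loop u : u <> [::] -> iter (k u).+1 (tree_rot k) (u, true) = (u, true).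
Proof.
move=> u0; case e : (k u) => [|n]; first by rewrite iterS tree_rot_up e.
rewrite iterS tree_iter_up ?e// subnn /=.
by case: u u0 {e}.
Qed.

Lemma tree_within r u : within t r u <-> in_tree k u /\ (size u <= r)%N.
Proof.
elim: r u => [|r IH] u.
  split=> [->//|[_]]; by rewrite leqn0 => /eqP/size0nil ->.
split=> [[/IH[-> /leqW]|]|[ut ur]] //.
  move=> [[v b] [/tree_dsetE[/= vt v0] /IH[]]]; case: b => /= _ vr <-.
    case: v v0 vt vr => //= j v _ /andP[_ ->] vr; split=> //.
    by rewrite (leq_trans (ltnW vr))// ltnW.
  by case: v v0 vt vr => //= j v _ -> vr.
case: (leqP (size u) r) => [ur'|ur']; first by left; apply/IH.
right; exists (u, false) => //; case: u ut ur ur' => //= j u /andP[ju ut] ur _.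
by split; [rewrite ju ut|apply/IH].
Qed.

(** Turning around a vertex from its parent meets the children in decreasing
    rank, then the parent again; at the root vertex the first child is
    followed by the last one. *)
Lemma tree_is_rot (x y : dart t) : (0 < k [::])%N -> dset t x -> dset t y ->
  (src x = src y <-> exists n, iter n (@rot t) x = y).
Proof.
move=> k0 mx my; split; last first.
  move=> [n <-]; elim: n => [//|n IH]; rewrite iterS.
  by rewrite (tree_rot_src (iter_rot_dset n (tree_dclosed k0) mx)).
pose R := reach (@rot t).
have down i j u : (i <= j)%N -> R (j :: u, false) (i :: u, false).
  by move=> ij; exists (j - i)%N; rewrite [RHS]/= tree_iter_down ?leq_subr// subKn.
have up i u : (i < k u)%N -> R (u, true) (i :: u, false).
  move=> iu; exists ((k u).-1 - i).+1; rewrite tree_iter_up.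
    by rewrite subKn//; case: (k u) iu.
  by apply: leq_ltn_trans (leq_subr _ _) _; case: (k u) iu.
have back j u : u <> [::] -> R (j :: u, false) (u, true).
  move=> u0; apply: reach_trans (down 0%N j u isT) _.
  by exists 1%N; case: u u0.
have root0 j : R ([:: j], false) ([:: (k [::]).-1], false).
  by apply: reach_trans (down 0%N j [::] isT) _; exists 1%N.
move/tree_dsetE: mx; move/tree_dsetE: my.
case: x y => [u b] [v c] /= [vt v0] [ut u0].
case: b; case: c; rewrite /tree_src /= => e.
- by rewrite e; exact: reach_refl.
- case: v v0 vt e => //= j v _ /andP[jv vt] e; subst v; exact: up.
- case: u u0 ut e => //= j u _ /andP[ju ut] e; subst u; exact: back.
case: v v0 vt e => //= j v _ /andP[jv vt]; case: u u0 ut => //= i u _ /andP[iu ut] e.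
subst u; case: v jv vt iu ut => [|l v] jv _ iu _.
  by apply: reach_trans (root0 i) _; apply: down; case: (k [::]) jv.
by apply: reach_trans (back _ _ _) _ => //; exact: up.
Qed.

(** The single face is the contour. From any dart it goes on to the last child
    of the root vertex, and from there it runs through the subtrees of all
    children, by decreasing rank. *)
Lemma tree_face (x y : dart t) : (0 < k [::])%N -> finite_set [set u | in_tree k u] ->
  dset t x -> dset t y -> reach (fun z : dart t => rot (rev z)) x y.
Proof.
move=> k0 /finite_seqP[s sE] mx my.
pose h := \max_(u <- s) size u.
have hP u : in_tree k u -> (size u <= h)%N.
  move=> ut; apply: (@leq_bigmax_seq _ s xpredT size u) => //.
  by have : [set u | in_tree k u] u by []; rewrite sE.
pose R := reach (fun z : dart t => rot (rev z)).
have sib j u : R (j.+1 :: u, true) (j :: u, false) by exists 1%N.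
(* The contour enters the subtree of [u], visits all the children of [u] and
   comes back to [u]; the induction goes down from the maximal height [h]. *)
have A : forall n u, (h - size u <= n)%N -> in_tree k u -> u <> [::] ->
    R (u, false) (u, true) /\ (forall j, (j < k u)%N -> R (u, false) (j :: u, false)).
  elim=> [|n IH] u hn ut u0.
    have ku : k u = 0%N.
      apply/eqP; rewrite -leqn0 leqNgt; apply/negP => ku.
      have /hP /= : in_tree k (0%N :: u) by rewrite /= ku ut.
      by move: hn; rewrite leqn0 subn_eq0 => /leq_ltn_trans h1 /h1; rewrite ltnn.
    by split; [exists 1%N; rewrite -[LHS]/(tree_rot k (u, true)) tree_rot_up ku|rewrite ku].
  case e : (k u) => [|m]; first by split=> //; exists 1%N; rewrite -[LHS]/(tree_rot k (u, true)) tree_rot_up e.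
  have ch j : (j < m.+1)%N -> in_tree k (j :: u) by rewrite /= e => ->.
  have Rc j : (j < m.+1)%N -> R (j :: u, false) (j :: u, true).
    move=> jm; have hs := hP _ (ch j jm).
    have hn' : (h - size (j :: u) <= n)%N by move: hn; rewrite /= subnS; case: (h - size u)%N.
    by have [] := IH (j :: u) hn' (ch j jm) (fun e => ltac:(discriminate)).
  have chain i : (i <= m)%N -> R (u, false) ((m - i)%N :: u, false).
    elim: i => [|i IHi] im; first by exists 1%N; rewrite -[LHS]/(tree_rot k (u, true)) tree_rot_up e subn0.
    apply: reach_trans (IHi (ltnW im)) _.
    have mi : (0 < m - i)%N by rewrite subn_gt0.
    have mi' : (m - i < m.+1)%N by rewrite ltnS leq_subr.
    apply: reach_trans (Rc _ mi') _.
    by rewrite subnS; case: (m - i)%N mi => // q _; exact: sib.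
  split; last by move=> j jm; rewrite -(@subKn j m)//; apply: chain; exact: leq_subr.
  apply: reach_trans (chain m (leqnn m)) _; rewrite subnn.
  by apply: reach_trans (Rc 0%N _) _ => //; exists 1%N; case: (u) u0.
have {}A u : in_tree k u -> u <> [::] ->
    R (u, false) (u, true) /\ (forall j, (j < k u)%N -> R (u, false) (j :: u, false)).
  by move=> ut u0; apply: (A _ u (leqnn _)).
have up0 n u j : size u = n -> in_tree k (j :: u) -> R (j :: u, true) ([:: (k [::]).-1], false).
  elim: n u j => [|n IH] u j su.
    rewrite (size0nil su); elim: j => [|j IHj] jt; first by exists 1%N.
    apply: reach_trans (sib _ _) _.
    have jt' : in_tree k [:: j] by move: jt; rewrite /= !andbT => /ltnW.
    by apply: reach_trans (IHj jt'); apply: (A _ jt' _).1.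
  elim: j => [|j IHj] jt.
    case: u su jt => // i u [su] jt; apply: (@reach_step _ _ (0%N :: i :: u, true)).
    by apply: IH => //; case/andP: jt.
  apply: reach_trans (sib _ _) _.
  have jt' : in_tree k (j :: u) by case/andP: jt => ju ut; rewrite /= (ltnW ju).
  by apply: reach_trans (IHj jt'); apply: (A _ jt' _).1.
have top : R x ([:: (k [::]).-1], false).
  move/tree_dsetE: mx; case: x => -[|j u] b /= [] // jt _.
  have h1 := up0 _ _ _ erefl jt; case: b => //.
  have h2 : R (j :: u, false) (j :: u, true) by apply: (A (j :: u) jt _).1.
  exact: reach_trans h2 h1.
apply: reach_trans top _.
have base i : (i < k [::])%N -> R ([:: (k [::]).-1], false) ([:: ((k [::]).-1 - i)%N], false).
  elim: i => [|i IH] ik; first by rewrite subn0; exact: reach_refl.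
  apply: reach_trans (IH (ltnW ik)) _.
  have ik' : ((k [::]).-1 - i < k [::])%N.
    by apply: leq_ltn_trans (leq_subr _ _) _; rewrite ltn_predL.
  apply: reach_trans (A [:: ((k [::]).-1 - i)%N] _ _).1 _ => //; first by rewrite /= ik'.
  have ki : (0 < (k [::]).-1 - i)%N by rewrite subn_gt0; case: (k [::]) ik.
  by rewrite subnS; case: ((k [::]).-1 - i)%N ki => // q _; exact: sib.
have all0 u : in_tree k u -> u <> [::] -> R ([:: (k [::]).-1], false) (u, false).
  elim: u => // j u IH /andP[ju ut] _; case: (eqVneq u [::]) => [u0|/eqP u0].
    subst u; rewrite -(@subKn j (k [::]).-1); last by case: (k [::]) ju.
    by apply: base; apply: leq_ltn_trans (leq_subr _ _) _; rewrite ltn_predL.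
  by apply: reach_trans (IH ut u0) _; apply: (A _ ut u0).2.
move/tree_dsetE: my; case: y => u b /= [ut u0].
have h1 := all0 _ ut u0; case: b => //.
exact: reach_trans h1 (A _ ut u0).1.
Qed.

(** Each word but the root is the upper end of one edge, so there is one more
    vertex than edges, and there is one face. *)
Lemma tree_euler : (0 < k [::])%N -> finite_set [set u | in_tree k u] ->
  euler_planar t.
Proof.
move=> k0 fin; pose A := [set u | in_tree k u] `\ [::].
have [e Ae] : finite_set A by apply: sub_finite_set fin => u [].
exists e.+1, e, 1%N; split.
- by apply/eq_cardSP; exists [::].
- apply: card_eq_trans Ae.
  have -> : edges t = (fun u => [set (u, true); (u, false)]) @` A.
    apply/seteqP; split=> [_ [[u b] /tree_dsetE/=[ut u0] <-]|_ [u [ut u0] <-]].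
      exists u => //; case: b => //; exact: setUC.
    by exists (u, true) => //; apply/tree_dsetE.
  apply: inj_card_eq => u v _ _ /seteqP[/(_ (u, true) (or_introl erefl)) + _].
  by case=> [[]|[]].
- have -> : faces t = [set dset t].
    have fE x : dset t x -> orbit_of (fun y : dart t => rot (rev y)) x = dset t.
      move=> mx; apply/seteqP; split=> [_ [n _ <-]|y my].
        elim: n => //= n IH; exact: (dclosed_rot (tree_dclosed k0) (dclosed_rev (tree_dclosed k0) IH)).
      by have [n <-] := tree_face k0 fin mx my; exists n.
    apply/seteqP; split=> [_ [x mx <-]|_ ->]; first exact: fE.
    exists (root t); last apply: fE; exact: dclosed_root (tree_dclosed k0).
  exact: card_set1.
- by rewrite addn1 addn2.
Qed.

End Tree.

Definition cut (r : nat) (k : seq nat -> nat) (u : seq nat) : nat :=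
  if (size u < r)%N then k u else 0%N.

Lemma in_tree_cut r k u : in_tree (cut r k) u = in_tree k u && (size u <= r)%N.
Proof.
elim: u => //= j u ->; rewrite /cut; case: (ltnP (size u) r) => [h|h].
  by rewrite (ltnW h) !andbT.
by rewrite ltn0 andbF.
Qed.

(** At a vertex of maximal height all the children are missing from the ball,
    so that turning around it comes straight back to the parent, as at a leaf.
    At lower heights nothing is missing. *)
Lemma tree_ball r k : map_iso (ball (tree_premap k) r.+1) (tree_premap (cut r.+1 k)).
Proof.
set t := tree_premap k; set b := ball t r.+1.
have bD (x : dart b) : dset b x <-> dset (tree_premap (cut r.+1 k)) x.
  rewrite tree_dsetE in_tree_cut; split.
    move=> [/tree_dsetE[xt x0] /tree_within[_ h1] /tree_within[_ h2]]; split=> //.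
    rewrite xt /=; case: x xt x0 h1 h2 => u []; by rewrite /tgt.
  move=> [/andP[xt xr] x0]; split; first exact/tree_dsetE.
    apply/tree_within; case: x xt xr x0 => u [] //=; case: u => //= j u /andP[_ ->].
    by move=> ur _; split=> //; exact: ltnW.
  rewrite /tgt; apply/tree_within; case: x xt xr x0 => u [] //=; case: u => //= j u /andP[_ ->].
  by move=> ur _; split=> //; exact: ltnW.
have idb (T : Type) (A B : set T) : A = B -> set_bij A B id.
  by move=> ->; split=> // x; exists x.
exists id, id; split=> //.
- apply: idb; apply/seteqP; split=> u h.
    by have [ut ur] := (@tree_within k r.+1 u).1 h; rewrite /= in_tree_cut ut ur.
  have : in_tree (cut r.+1 k) u by [].
  by rewrite in_tree_cut => /andP[ut ur]; apply/tree_within.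
- by apply: idb; apply/seteqP; split=> x /bD.
move=> x xb; split=> //; symmetry.
change (first_return (dset b) (tree_rot k) x = tree_rot (cut r.+1 k) x).
have := xb; move=> /bD /tree_dsetE; rewrite in_tree_cut.
case: x xb => u c xb; rewrite [(u, c).1]/= => -[/andP[ut ur] u0].
case: c xb => xb.
  have [ur'|ur'] := ltnP (size u) r.+1.
    have e : tree_rot (cut r.+1 k) (u, true) = iter 1 (tree_rot k) (u, true).
      by rewrite /iter !tree_rot_up /cut ur'.
    rewrite e; apply: first_return_eq => //.
    rewrite /iter tree_rot_up; case ek : (k u) => [|j] //; apply/bD/tree_dsetE; split=> //.
    by rewrite in_tree_cut /= ut ur' ek ltnSn.
  have e : cut r.+1 k u = 0%N by rewrite /cut ltnNge ur'.
  have -> : tree_rot (cut r.+1 k) (u, true) = (u, true) by rewrite tree_rot_up e.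
  rewrite -[RHS](@tree_iter_loop k u u0); apply: first_return_eq.
    by rewrite tree_iter_loop.
  move=> i iu; rewrite tree_iter_up// => /bD/tree_dsetE[].
  by rewrite in_tree_cut /= [(size u < _)%N]ltnNge ur' !andbF.
case: u u0 ut ur xb => // j u _; rewrite [in_tree k _]/= [size _]/= => /andP[ju ut] ur xb.
have e : tree_rot (cut r.+1 k) (j :: u, false) = iter 1 (tree_rot k) (j :: u, false).
  by case: (j); case: (u).
rewrite e; apply: first_return_eq => //; apply/bD/tree_dsetE.
case: j ju xb {e} => [|j] ju xb; last first.
  by rewrite in_tree_cut /= ut (ltnW ju) ur.
case: u ur ut ju xb => [|i u] ur ut ju xb.
  by rewrite in_tree_cut /= !andbT prednK.
by rewrite in_tree_cut ut (ltnW ur).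
Qed.

Lemma tree_fin r k : finite_set [set u | in_tree (cut r k) u].
Proof.
have -> : [set u | in_tree (cut r k) u] =
    \bigcup_(n in `I_r.+1) [set u | in_tree k u && (size u == n)].
  apply/seteqP; split=> u /=; rewrite in_tree_cut.
    by move=> /andP[ut ur]; exists (size u) => //=; rewrite ut eqxx.
  by move=> [n /= nr /andP[-> /eqP ->]].
apply: bigcup_finite => // n _; elim: n => [|n IH].
  by apply: sub_finite_set (finite_set1 [::]) => u /andP[_ /nilP].
apply: (@sub_finite_set _ _ (\bigcup_(u in [set u | in_tree k u && (size u == n)])
   ((fun j => j :: u) @` `I_(k u)))).
  by move=> [//|j u] /andP[/andP[ju ut]] /= un; exists u; [apply/andP|exists j].
by apply: bigcup_finite => // u _; exact: finite_image.
Qed.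

(** The root edge needs a child of the root vertex. Planarity reduces to
    finite trees by [tree_ball]. *)
Lemma tree_is_map k : (0 < k [::])%N -> is_map (tree_premap k).
Proof.
move=> k0; have tc := tree_dclosed k0; split.
- exact: dclosed_src.
- by move=> x mx; split; [exact: dclosed_rev|case: x mx => u []|case: x mx => u []].
- exact: dclosed_rot.
- by move=> x y; exact: tree_is_rot.
- exact: dclosed_root.
- by move=> u ut; exists (size u); apply/tree_within.
move=> r; have c0 : (0 < cut r.+1 k [::])%N by [].
have tb := tree_ball r k.
have tcc := tree_dclosed c0.
have bc : dclosed (ball (tree_premap k) r.+1).
  split.
  - by move=> x [].
  - by move=> [u []] [mx h1 h2].
  - move=> x xD /=; rewrite /first_return.
    by case: xgetP => [y -> [n [-> //]]|].
  - split; first by rewrite /= k0.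
      by apply/(@tree_within k r.+1).
    by apply/(@tree_within k r.+1); rewrite /= k0.
apply: euler_planar_iso tcc (map_iso_sym bc tb) _.
exact: tree_euler (tree_fin _ _).
Qed.

Definition tree_map (k : seq nat -> nat) : rmap := to_rmap (tree_premap k).

(** Both trees then have the same vertices up to height [r] ([agree_in_tree]),
    so that this relation is symmetric. *)
Definition agree (r : nat) (k k' : seq nat -> nat) :=
  forall u, in_tree k u -> (size u < r)%N -> k u = k' u.

Lemma agree_in_tree r k k' u : agree r k k' -> (size u <= r)%N ->
  in_tree k u = in_tree k' u.
Proof.
move=> kk; elim: u => //= j u IH ur; rewrite IH ?(ltnW ur)//.
case ut : (in_tree k' u); last by rewrite !andbF.
by rewrite kk// IH// ltnW.
Qed.

Lemma agree_sym r k k' : agree r k k' -> agree r k' k.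
Proof.
move=> kk u ut ur; rewrite kk// (agree_in_tree kk)// ltnW//.
Qed.

Lemma agree_trans r k k' k'' : agree r k k' -> agree r k' k'' -> agree r k k''.
Proof.
move=> h1 h2 u ut ur; rewrite h1// h2// -(agree_in_tree h1)// ltnW//.
Qed.

Lemma agree_sub r r' k k' : (r <= r')%N -> agree r' k k' -> agree r k k'.
Proof. by move=> rr h u ut ur; apply: h => //; exact: leq_trans rr. Qed.

Lemma agree_ball r k k' : (0 < k [::])%N -> agree r.+1 k k' ->
  map_iso (ball (tree_premap k) r.+1) (ball (tree_premap k') r.+1).
Proof.
move=> k0 kk; have k0' : (0 < k' [::])%N by rewrite -kk.
apply: map_iso_trans (tree_ball r k) _.
apply: (@map_iso_trans _ (tree_premap (cut r.+1 k'))); last first.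
  apply: map_iso_sym (tree_ball r k'); apply: dclosed_ball; exact: tree_is_map.
have itE u : in_tree (cut r.+1 k) u = in_tree (cut r.+1 k') u.
  rewrite !in_tree_cut; case: (leqP (size u) r.+1) => h; last by rewrite !andbF.
  by rewrite (agree_in_tree kk h).
exists id, id; split=> //.
- split=> // [u /=|u /= ut]; first by rewrite itE.
  by exists u; rewrite //= itE.
- split=> // [u /=|u /= ut]; first by rewrite itE.
  by exists u; rewrite //= itE.
have cE u : in_tree (cut r.+1 k) u -> cut r.+1 k u = cut r.+1 k' u.
  rewrite in_tree_cut /cut => /andP[ut _]; case: ifP => // ur; exact: kk.
move=> x /tree_dsetE[xt x0]; split=> //; case: x xt x0 => -[|j u] [] // xt _.
  by rewrite /= -cE.
by case: j xt => [|j] xt //=; case: u xt => //= _; rewrite -cE.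
Qed.

Lemma tree_mapE k (k0 : (0 < k [::])%N) : premap_of (tree_map k) = tree_premap k.
Proof.
rewrite /tree_map /to_rmap; case: pselect => // nk; case: nk; exact: tree_is_map.
Qed.

Lemma tree_map0 k : k [::] = 0%N -> tree_map k = edge_map.
Proof.
move=> k0; rewrite /tree_map /to_rmap; case: pselect => // h.
by have := is_map_root h; rewrite /= k0.
Qed.

Definition depth_determined (r : nat) (H : set (seq nat -> nat)) :=
  forall k k', agree r k k' -> H k -> H k'.

(** The trees whose levels below [r] force their map to be in [A]. *)
Definition ball_core (A : set rmap) (r : nat) : set (seq nat -> nat) :=
  [set k | forall k', agree r k k' -> A (tree_map k')].

Lemma ball_core_determined A r : depth_determined r (ball_core A r).
Proof.
by move=> k k' kk h k'' kk'; apply: h; exact: agree_trans kk'.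
Qed.

Lemma ball_core_mono A r r' : (r <= r')%N -> ball_core A r `<=` ball_core A r'.
Proof. by move=> rr k h k' kk; apply: h; exact: agree_sub kk. Qed.

(** Around a map, an open set contains all maps with the same ball of some
    radius, and this ball is determined by finitely many levels. When the root
    vertex has no child the map is the default one, and level 0 decides. *)
Lemma open_ball_core (R : realType) (A : set rmap) k : dmap_open R A ->
  A (tree_map k) <-> exists r, ball_core A r k.
Proof.
move=> Ao; split=> [Ak|[r]]; last by apply=> u.
have [k0|k0] := posnP (k [::]).
  by exists 1%N => k' kk; rewrite tree_map0 -?kk//; rewrite tree_map0 in Ak.
have [e e0 he] := Ao _ Ak; have [r re] := small_radius e0.
exists r.+1 => k' kk; have k0' : (0 < k' [::])%N by rewrite -kk.
by apply: he; apply: dmap_lt re; rewrite !tree_mapE//; exact: agree_ball.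
Qed.

(** * Forests coded by a walk *)

(** A finite plane forest in the form of a binary tree: [FCons c s] is a tree
    whose root carries the forest [c], followed by the trees of [s]. *)
Inductive forest : Set := FNil | FCons of forest & forest.

Fixpoint nb_nodes (f : forest) : nat :=
  if f is FCons c s then (nb_nodes c + nb_nodes s).+1 else 0%N.

Fixpoint nb_trees (f : forest) : nat := if f is FCons _ s then (nb_trees s).+1 else 0%N.

Definition upstep (b : int -> int) (i : int) : bool := b (i + 1) == b i + 1.

(** A forest with [n] vertices takes [2 n] steps of the walk. *)
Definition left_end (x : int) (f : forest) : int := x - (2 * nb_nodes f)%:Z.

(** Backwards from time [x], the walk follows the contour of [f]: a tree is
    read as the down-step [x - 1], the forest carried by its root, and the
    up-step that closes it. *)
Fixpoint reads (b : int -> int) (x : int) (f : forest) : Prop :=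
  if f is FCons c s then
    [/\ downstep b (x - 1), reads b (x - 1) c, upstep b (left_end x c - 2)
      & reads b (left_end x c - 2) s]
  else True.

(** The down-steps at which the roots of the trees are read. *)
Fixpoint root_pos (x : int) (f : forest) : seq int :=
  if f is FCons c s then (x - 1) :: root_pos (left_end x c - 2) s else [::].

Lemma size_root_pos x f : size (root_pos x f) = nb_trees f.
Proof. by elim: f x => //= c _ s IH x; rewrite IH. Qed.

Lemma root_pos_bound x f i : i \in root_pos x f -> left_end x f <= i < x.
Proof.
elim: f x => // c _ s IH x /=; rewrite inE => /orP[/eqP->|/IH]; rewrite /left_end /=; lia.
Qed.

Lemma root_pos_sorted x f : sorted (fun i j => j < i) (root_pos x f).
Proof.
elim: f x => // c _ s IH x /=; have := IH (left_end x c - 2).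
case E : (root_pos _ s) => [//|y l] /= ->; rewrite andbT.
have : y \in root_pos (left_end x c - 2) s by rewrite E inE eqxx.
by move/root_pos_bound; rewrite /left_end; lia.
Qed.

Lemma reads_level b x f : reads b x f ->
  b (left_end x f) = b x /\ forall i, left_end x f <= i <= x -> b x <= b i.
Proof.
elim: f x => [|c IHc s IHs] x /=.
  move=> _; rewrite /left_end /= muln0 subr0; split=> // i; rewrite -eq_le => /eqP ->; exact: lexx.
move=> [dx /IHc[c1 c2] ux /IHs[s1 s2]].
have e : left_end (left_end x c - 2) s = left_end x (FCons c s) by rewrite /left_end /=; lia.
rewrite {}e in s1 s2.
have ec : left_end (x - 1) c = left_end x c - 1 by rewrite /left_end; lia.
rewrite ec in c1 c2.
move: dx ux; rewrite /downstep /upstep.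
have -> : x - 1 + 1 = x by lia.
have -> : left_end x c - 2 + 1 = left_end x c - 1 by lia.
move=> /eqP dx /eqP ux; split; first lia.
move=> i hi; have [h|h] := leP i (left_end x c - 2); first by have := s2 i; lia.
have [h'|h'] := leP i (x - 1); first by have := c2 i; lia.
by have -> : i = x by lia.
Qed.

(** Within a tree of [f] the walk stays above the level of [x], so a down-step
    to this level can only be the root of a tree. *)
Lemma root_posP b x f i : reads b x f -> left_end x f <= i < x ->
  (i \in root_pos x f) = downstep b i && (b i == b x + 1).
Proof.
elim: f x => [|c IHc s IHs] x /=.
  by move=> _; rewrite /left_end /=; lia.
move=> [dx /reads_level[c1 c2] ux rs] hi; have [s1 s2] := reads_level rs.
have e : left_end (left_end x c - 2) s = left_end x (FCons c s) by rewrite /left_end /=; lia.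
have ec : left_end (x - 1) c = left_end x c - 1 by rewrite /left_end; lia.
rewrite ec in c1 c2; rewrite e in s1 s2.
have dx' : b x = b (x - 1) - 1 by move: dx; rewrite /downstep subrK => /eqP.
have ux' : b (left_end x c - 1) = b (left_end x c - 2) + 1.
  by move: ux; rewrite /upstep (_ : left_end x c - 2 + 1 = left_end x c - 1); [move=> /eqP|lia].
rewrite inE.
case: eqP => [->|ne] /=; first by rewrite dx /=; lia.
have [h|h] := ltP i (left_end x c - 2).
  rewrite IHs ?e//; first by congr (_ && (_ == _)); lia.
  by rewrite h; lia.
have -> : (i \in root_pos (left_end x c - 2) s) = false.
  by apply/negP => /root_pos_bound; lia.
symmetry; apply/negP => /andP[/eqP di /eqP bi].
have [h'|h'] := leP i (left_end x c - 2).
  have ei : i = left_end x c - 2 by lia.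
  by move: bi di; rewrite ei; lia.
by have := c2 (i + 1); lia.
Qed.

(** A longest forest is determined by the walk: the step [x - 1] tells whether
    it is empty, and if not, both the forest carried by the first root and the
    rest are again longest forests. *)
Lemma reads_uniq b x f f' : reads b x f -> upstep b (left_end x f - 1) ->
  reads b x f' -> upstep b (left_end x f' - 1) -> f = f'.
Proof.
have absurd y : upstep b y -> downstep b y -> False by rewrite /upstep /downstep; lia.
elim: f x f' => [|c IHc s IHs] x [|c' s'] //.
- move=> _ u [d _ _ _] _; case: (absurd (x - 1)) => //.
  by move: u; rewrite /left_end /= muln0 subr0.
- move=> [d _ _ _] _ _ u; case: (absurd (x - 1)) => //.
  by move: u; rewrite /left_end /= muln0 subr0.
move=> [d rc uc rs] us [_ rc' uc' rs'] us'.
have ec : c = c'.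
  apply: (IHc (x - 1)) => //.
    by have -> : left_end (x - 1) c - 1 = left_end x c - 2 by rewrite /left_end; lia.
  by have -> : left_end (x - 1) c' - 1 = left_end x c' - 2 by rewrite /left_end; lia.
subst c'; congr FCons; apply: (IHs (left_end x c - 2)) => //.
  by have -> : left_end (left_end x c - 2) s = left_end x (FCons c s) by rewrite /left_end /=; lia.
by have -> : left_end (left_end x c - 2) s' = left_end x (FCons c s') by rewrite /left_end /=; lia.
Qed.

Lemma leastE (A : set int) (k : int) : A k -> (forall l, A l -> k <= l) -> least A = k.
Proof.
move=> Ak kA; apply: xget_unique; first by split=> // l /kA.
by move=> l [Al lA]; apply/le_anti; rewrite kA// lA.
Qed.

Section Walk.
Variable b : int -> int.
Hypothesis bo : oscillating b.

Let bstep i : b (i + 1) = b i + 1 \/ b (i + 1) = b i - 1.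
Proof. by case: bo. Qed.

Lemma updown i : upstep b i = ~~ downstep b i.
Proof. by rewrite /upstep /downstep; case: (bstep i) => ->; lia. Qed.

Lemma first_below i : exists k, [/\ i < k, b k = b i - 1 &
  forall l, i <= l < k -> b i <= b l].
Proof.
have [_ /(_ i (b i - 1))[[k ik bk] _]] := bo.
have ex : exists n : nat, b (i + n%:Z) <= b i - 1.
  by exists (absz (k - i)); have -> : i + (absz (k - i))%:Z = k by lia.
case: (ex_minnP ex) => n bn nmin; exists (i + n%:Z).
have n0 : (0 < n)%N by case: n bn {nmin} => //; rewrite addr0; lia.
have low (l : int) : i <= l < i + n%:Z -> b i <= b l.
  move=> hl; rewrite leNgt; apply/negP => bl.
  have /nmin : b (i + (absz (l - i))%:Z) <= b i - 1.
    by rewrite (_ : i + (absz (l - i))%:Z = l); lia.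
  by lia.
split=> //; first by lia.
have := low (i + n%:Z - 1); case: (bstep (i + n%:Z - 1)); rewrite subrK; lia.
Qed.

Lemma last_below i : exists k, [/\ k < i, b k = b i - 1 &
  forall l, k < l <= i -> b i <= b l].
Proof.
have [_ /(_ i (b i - 1))[_ [k ki bk]]] := bo.
have ex : exists n : nat, b (i - n%:Z) <= b i - 1.
  by exists (absz (k - i)); have -> : i - (absz (k - i))%:Z = k by lia.
case: (ex_minnP ex) => n bn nmin; exists (i - n%:Z).
have n0 : (0 < n)%N by case: n bn {nmin} => //; rewrite subr0; lia.
have low (l : int) : i - n%:Z < l <= i -> b i <= b l.
  move=> hl; rewrite leNgt; apply/negP => bl.
  have /nmin : b (i - (absz (l - i))%:Z) <= b i - 1.
    by rewrite (_ : i - (absz (l - i))%:Z = l); lia.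
  by lia.
split=> //; first by lia.
have h : b i <= b (i - n%:Z + 1) by apply: low; lia.
by case: (bstep (i - n%:Z)) => e; rewrite e in h; lia.
Qed.

Lemma phi_uniq i k : i <= k -> b k = b i -> downstep b k ->
  (forall l, i <= l <= k -> b i <= b l) -> phi b i = k.
Proof.
move=> ik bk dk low; apply: leastE; first by [].
move=> l [dl il bl]; rewrite leNgt; apply/negP => lk.
by have := low (l + 1); move: dl; rewrite /downstep; lia.
Qed.

(** The time [phi b i] comes right before the first passage below the level of
    [i]. *)
Lemma phiP i : [/\ i <= phi b i, b (phi b i) = b i, downstep b (phi b i) &
  forall l, i <= l <= phi b i -> b i <= b l].
Proof.
have [k [ik bk low]] := first_below i.
have e : phi b i = k - 1.
  have bk1 : b (k - 1) = b i.
    by have := low (k - 1); case: (bstep (k - 1)); rewrite subrK; lia.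
  apply: phi_uniq => //; first by lia.
    by rewrite /downstep subrK; lia.
  by move=> l hl; apply: low; lia.
have bk1 : b (k - 1) = b i.
  by have := low (k - 1); case: (bstep (k - 1)); rewrite subrK; lia.
rewrite e; split=> //; first by lia.
  by rewrite /downstep subrK; lia.
by move=> l hl; apply: low; lia.
Qed.

(** Right after the down-step [i] the walk is at the level of the
    successor. *)
Lemma succE i : downstep b i -> successor b i = phi b (i + 1).
Proof.
move=> /eqP di; have [h1 h2 h3 h4] := phiP (i + 1); apply: leastE.
  by split=> //; [lia|rewrite h2 di].
move=> l [dl il bl]; rewrite leNgt; apply/negP => lk.
by have := h4 (l + 1); move: dl; rewrite /downstep; lia.
Qed.

Lemma succP i : downstep b i -> [/\ i < successor b i, b (successor b i) = b i - 1,
  downstep b (successor b i) & forall l, i <= l <= successor b i -> b i - 1 <= b l].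
Proof.
move=> di; rewrite succE//; move: (di) => /eqP e; have [h1 h2 h3 h4] := phiP (i + 1).
split=> //; [lia|lia|].
move=> l hl; have [->|ne] := eqVneq l i; first by lia.
by have := h4 l; lia.
Qed.

(** If [y < x], then [x - 1] is a down-step, and the last time [z] before it
    at the level of [x] separates the tree rooted at [x - 1] from the trees
    further to the left. *)
Lemma forest_between x y : y <= x -> b y = b x ->
  (forall l, y <= l <= x -> b x <= b l) -> exists f, reads b x f /\ left_end x f = y.
Proof.
suff H : forall n x y, x - y <= n%:Z -> y <= x -> b y = b x ->
    (forall l, y <= l <= x -> b x <= b l) -> exists f, reads b x f /\ left_end x f = y.
  by apply: (H (absz (x - y))); lia.
have nil_case z : exists f, reads b z f /\ left_end z f = z.
  by exists FNil; split=> //; rewrite /left_end /= muln0 subr0.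
elim=> [|n IH] {}x {}y hn yx bs low.
  by have -> : y = x by lia.
have [->|ne] := eqVneq y x; first exact: nil_case.
have bx : b (x - 1) = b x + 1.
  have h : b x <= b (x - 1) by apply: low; lia.
  by case: (bstep (x - 1)); rewrite subrK => e; lia.
have [z [zx bz lowz]] := last_below (x - 1).
have yz : y <= z.
  rewrite leNgt; apply/negP => zy.
  by have := lowz y; lia.
have bz1 : b (z + 1) = b (x - 1).
  have h : b (x - 1) <= b (z + 1) by apply: lowz; lia.
  by case: (bstep z) => e; rewrite e in h *; lia.
have [||||c [rc ec]] := IH (x - 1) (z + 1) => //; [lia|lia| |].
  by move=> l hl; apply: lowz; lia.
have [||||f [rf ef]] := IH z y => //; [lia|lia| |].
  by move=> l hl; have := low l; lia.
exists (FCons c f).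
have e : left_end x c - 2 = z by move: ec; rewrite /left_end; lia.
split; last by move: ef e; rewrite /left_end /=; lia.
rewrite /= e; split=> //; first by rewrite /downstep subrK bx; lia.
by rewrite /upstep bz1 bz; lia.
Qed.

Lemma forest_ex x : exists f, reads b x f /\ upstep b (left_end x f - 1).
Proof.
have [s [sx bs low]] := last_below x.
have bs1 : b (s + 1) = b x.
  have h : b x <= b (s + 1) by apply: low; lia.
  by case: (bstep s) => e; rewrite e in h *; lia.
have [|||f [rf ef]] := @forest_between x (s + 1) => //; first by lia.
  by move=> l hl; apply: low; lia.
exists f; split=> //; rewrite ef /upstep (_ : s + 1 - 1 = s); last by lia.
by rewrite bs1 bs subrK.
Qed.

(** The longest forest read from [x], up to the last passage below the level
    of [x]; at a down-step it consists of the descendants. *)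
Definition left_forest (x : int) : forest :=
  xget (FNil : {classic forest}) [set f | reads b x f /\ upstep b (left_end x f - 1)].

Lemma left_forestP x : reads b x (left_forest x) /\ upstep b (left_end x (left_forest x) - 1).
Proof.
exact: (@xgetPex {classic forest} FNil [set f | reads b x f /\ upstep b (left_end x f - 1)] (forest_ex x)).
Qed.

Lemma left_forest_uniq x f : reads b x f -> upstep b (left_end x f - 1) -> left_forest x = f.
Proof. by move=> rf uf; have [r u] := left_forestP x; exact: reads_uniq r u rf uf. Qed.

Definition preds (v : int) : seq int := root_pos v (left_forest v).

(** A down-step one level above [v], on its left, has [v] for successor
    exactly when the walk does not go below the level of [v] in between, that
    is, when it is in the longest forest read from [v]. *)
Lemma predsP v i : downstep b v -> i \in preds v <-> downstep b i /\ successor b i = v.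
Proof.
move=> dv; have [r u] := left_forestP v; have [l1 l2] := reads_level r.
split=> [iv|[di si]].
  have hi := root_pos_bound iv; move: iv; rewrite /preds (root_posP r)// => /andP[di /eqP bi].
  split=> //; rewrite succE//; move: (di) => /eqP e; apply: phi_uniq => //; [lia|lia|].
  by move=> l hl; have := l2 l; lia.
have [h1 h2 _ h4] := succP di; rewrite si in h1 h2 h4.
rewrite /preds (root_posP r) ?di /=; first by lia.
rewrite h1 andbT leNgt; apply/negP => hi.
have e : b (left_end v (left_forest v) - 1) = b v - 1.
  by move: u; rewrite /upstep subrK l1 => /eqP; lia.
have [ei|ne] := eqVneq i (left_end v (left_forest v) - 1); first by rewrite -ei in e; lia.
have fv : left_end v (left_forest v) <= v by rewrite /left_end; lia.
have h : b i - 1 <= b (left_end v (left_forest v) - 1) by apply: h4; lia.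
by rewrite e in h; lia.
Qed.

Lemma preds_lt v i : i \in preds v -> i < v.
Proof. by move/root_pos_bound => /andP[]. Qed.

(** The neighbors in clockwise order: the end of the only arc to the right,
    then the ends of the arcs to the left, from the narrowest to the
    widest. *)
Definition nbr (v : int) : seq int := successor b v :: preds v.

Lemma nbr_sorted v : downstep b v -> sorted (fun i j => j < i) (nbr v).
Proof.
move=> dv; rewrite /nbr /=; have := root_pos_sorted v (left_forest v); rewrite -/(preds v).
case E : (preds v) => [//|y l] /= ->; rewrite andbT.
have [h _ _ _] := succP dv; apply: lt_trans h; apply: preds_lt.
by rewrite E inE eqxx.
Qed.

Lemma nbr_uniq v : downstep b v -> uniq (nbr v).
Proof.
move=> dv; apply: (sorted_uniq _ _ (nbr_sorted dv)).
  by move=> x y z h1 h2; exact: lt_trans h2 h1.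
by move=> x; exact: ltxx.
Qed.

Lemma nbr_sym v w : downstep b v -> w \in nbr v -> downstep b w /\ v \in nbr w.
Proof.
move=> dv; rewrite inE => /orP[/eqP->|/(predsP _ dv)[dw sw]].
  have [_ _ ds _] := succP dv; split=> //.
  by rewrite inE; apply/orP; right; apply/(predsP _ ds).
by split=> //; rewrite -sw inE eqxx.
Qed.

(** The dart from [v] to its neighbor [w]. *)
Definition arc (v w : int) : int * bool :=
  if w == successor b v then (v, true) else (w, false).

Lemma nbrP v w : downstep b v -> w \in nbr v ->
  w = successor b v \/ (successor b w = v /\ downstep b w).
Proof.
by move=> dv; rewrite inE => /orP[/eqP->|/(predsP _ dv)[dw sw]]; [left|right].
Qed.

Lemma arc_srcE v w : downstep b v -> w \in nbr v -> arc_src b (arc v w) = v.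
Proof.
move=> dv /(nbrP dv)[->|[sw dw]]; rewrite /arc ?eqxx//.
by case: eqP => // _; rewrite /arc_src.
Qed.

Lemma arc_revE v w : downstep b v -> w \in nbr v -> arc_rev (arc v w) = arc w v.
Proof.
move=> dv /(nbrP dv)[->|[sw dw]]; rewrite /arc.
  have [h _ ds _] := succP dv; have [h' _ _ _] := succP ds.
  rewrite eqxx; case: eqP => // e; move: h'; rewrite -e; lia.
rewrite sw eqxx; case: eqP => // e.
have [h _ _ _] := succP dw; have [h' _ _ _] := succP dv; lia.
Qed.

Lemma arc_down v w : downstep b v -> w \in nbr v -> downstep b (arc v w).1.
Proof.
by move=> dv wv; have [dw _] := nbr_sym dv wv; rewrite /arc; case: ifP.
Qed.

Lemma arc_inj v w v' w' : downstep b v -> w \in nbr v -> downstep b v' -> w' \in nbr v' ->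
  arc v w = arc v' w' -> v = v' /\ w = w'.
Proof.
move=> dv wv dv' wv' e; have [dw vw] := nbr_sym dv wv; have [dw' vw'] := nbr_sym dv' wv'.
split; first by rewrite -(arc_srcE dv wv) e arc_srcE.
by rewrite -(arc_srcE dw vw) -arc_revE// e arc_revE// arc_srcE.
Qed.

Lemma arc_sur x : downstep b x.1 -> exists v w, [/\ downstep b v, w \in nbr v & x = arc v w].
Proof.
case: x => i c /= di; have h : successor b i \in nbr i by rewrite inE eqxx.
have [ds is_] := nbr_sym di h.
case: c; first by exists i, (successor b i); rewrite /arc eqxx.
exists (successor b i), i; split=> //; rewrite -arc_revE// /arc eqxx//.
Qed.

End Walk.

(** * The tree of a walk *)

Lemma sorted_nth_lt (p : seq int) (x0 : int) i j : sorted (fun i j => j < i) p ->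
  (i < j < size p)%N -> nth x0 p j < nth x0 p i.
Proof.
move=> ps /andP[ij js].
have tr : transitive (fun i j : int => j < i) by move=> y x z h1 h2; exact: lt_trans h2 h1.
by apply: (sorted_ltn_nth tr x0 ps); rewrite ?inE // (ltn_trans ij).
Qed.

Section Unfold.
Variable b : int -> int.
Hypothesis bo : oscillating b.

Notation nbr := (nbr b).
Notation arc := (arc b).
Notation preds := (preds b).

(** The neighbors are listed clockwise and [arc_rot] is counterclockwise. As
    the predecessors are listed in decreasing order, the least one is the
    last, and the least one greater than [w] is just before [w]. *)
Lemma arc_rotP v w : downstep b v -> w \in nbr v ->
  arc_rot b (arc v w) = arc v (prev (nbr v) w).
Proof.
move=> dv wv; have un := nbr_uniq bo dv; have ps := nbr_sorted bo dv.
have srcE := arc_srcE bo dv wv.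
rewrite /arc_rot srcE prev_nth wv.
have predE (l : int) : predecessors b v l <-> l \in preds v by split=> /(predsP bo _ dv).
have [ew|nw] := eqVneq w (successor b v).
  have wp : w \notin preds v by rewrite ew; case/andP: un.
  rewrite /= (memNindex wp) nth_last /= /arc ew eqxx /=.
  case E : (preds v) => [|y l].
    rewrite /= eqxx; case: asboolP => // -[z /predE]; by rewrite E.
  case: asboolP => [_|[]]; last by exists y; apply/predE; rewrite E inE eqxx.
  have lp : last y l \in preds v by rewrite E mem_last.
  have lt := preds_lt lp; have [h _ _ _] := succP bo dv.
  rewrite /= ifF; last by apply/negP => /eqP; lia.
  congr pair; apply: leastE; first exact/predE.
  move=> z /predE; rewrite E => zl.
  have ps' : sorted (fun i j => j < i) (y :: l) by rewrite -E; exact: root_pos_sorted.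
  rewrite (last_nth 0) -(nth_index 0 zl).
  have iz : (index z (y :: l) < size (y :: l))%N by rewrite index_mem.
  move: (iz); rewrite [size _]/= ltnS leq_eqVlt => /orP[/eqP ->|iz']; first exact: lexx.
  by apply: ltW; apply: sorted_nth_lt => //=; rewrite iz' /=.
have wp : w \in preds v by move: wv; rewrite inE (negbTE nw).
have -> : arc v w = (w, false) by rewrite /arc (negbTE nw).
rewrite [(w, false).2]/= [(w, false).1]/=.
pose j := index w (preds v).
have jp : (j < size (preds v))%N by rewrite index_mem.
have ew : nth 0 (preds v) j = w by rewrite nth_index.
have plS := root_pos_sorted v (left_forest b v).
rewrite /nbr -/j; case Ej : j => [|i] /=.
  rewrite /arc eqxx; case: asboolP => // -[z [/predE zp /= wz]]; exfalso.
  have iz : (index z (preds v) < size (preds v))%N by rewrite index_mem.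
  have := @sorted_nth_lt _ 0 j (index z (preds v)) plS.
  rewrite ew nth_index// Ej iz andbT lt0n.
  have [e0 _|_ /(_ isT)] := eqVneq (index z (preds v)) 0%N; last first.
  by lia.
  by have := nth_index 0 zp; rewrite e0 -Ej ew => ez; move: wz; rewrite ez ltxx.
have ip : (i < size (preds v))%N by rewrite (ltn_trans _ jp)// Ej.
set u := nth _ _ i.
have uE : u = nth 0 (preds v) i by apply: set_nth_default.
have up : u \in preds v by exact: mem_nth.
have wu : w < u by rewrite uE -ew; apply: sorted_nth_lt => //; rewrite jp Ej ltnSn.
have lt := preds_lt up; have [h _ _ _] := succP bo dv.
have -> : arc v u = (u, false).
  rewrite /arc ifF//; apply/negP => /eqP eu.
  by move: (lt_trans lt h); rewrite eu ltxx.
case: asboolP => [_|[]]; last by exists u; split=> //; exact/predE.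
congr pair; apply: leastE; first by split=> //; exact/predE.
move=> z [/predE zp /= wz].
have iz : (index z (preds v) < size (preds v))%N by rewrite index_mem.
have [hz|hz] := leqP (index z (preds v)) i.
  move: hz; rewrite leq_eqVlt => /orP[/eqP e|hz]; first by rewrite uE -e nth_index.
  have : nth 0 (preds v) i < nth 0 (preds v) (index z (preds v)).
    by apply: sorted_nth_lt => //; rewrite hz ip.
  by rewrite -uE nth_index//; exact: ltW.
move: hz; rewrite -Ej leq_eqVlt => /orP[/eqP e|hz].
  by have := nth_index 0 zp; rewrite -e ew => ez; move: wz; rewrite ez ltxx.
have := @sorted_nth_lt _ 0 j (index z (preds v)) plS.
by rewrite hz iz ew nth_index// => /(_ isT); lia.
Qed.

(** If 0 is a down-step, then it is [phi b 0], and [phi b 1] is its successor.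
    Otherwise [phi b 1] steps down to the level of 0, and its successor is
    [phi b 0]. *)
Lemma phi01 : phi b 1 \in nbr (phi b 0).
Proof.
have [h1 h2 h3 h4] := phiP bo 0.
rewrite inE; case d0 : (downstep b 0).
  have -> : phi b 0 = 0.
    apply: phi_uniq => // l hl; by have -> : l = 0 by lia.
  by rewrite succE// add0r eqxx.
have u0 : b 1 = b 0 + 1.
  have := updown bo 0; rewrite d0 /upstep add0r; by move/eqP.
have [k1 k2 k3 k4] := phiP bo 1.
apply/orP; right; apply/(predsP bo _ h3); split=> //.
rewrite (succE bo k3); symmetry; move: (k3) => /eqP k3'.
have [l1 l2 l3 l4] := phiP bo (phi b 1 + 1).
have e1 : b (phi b 1 + 1) = b 0 by rewrite k3' k2 u0 addrK.
apply: phi_uniq => //; [by apply: le_trans l1; rewrite addr_ge0 // (le_trans _ k1)|by rewrite l2 e1|].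
move=> l /andP[hl0 hl2]; have [hl1|hl1] := leP (phi b 1 + 1) l.
  by rewrite -e1; apply: l4; rewrite hl1.
have [->|l0] := eqVneq l 0; first exact: lexx.
have l1' : 1 <= l by move: (phi b 1) hl0 l0 => _; lia.
by apply: le_trans (k4 l _); [rewrite u0 lerDl|rewrite l1' -ltzD1].
Qed.

Let v0 := phi b 0.
Let dv0 : downstep b v0. Proof. by have [] := phiP bo 0. Qed.

Lemma arc_rootE : arc_root b = arc v0 (phi b 1).
Proof.
have p01 := phi01; apply: xget_unique.
  split; first exact: arc_down.
    exact: arc_srcE.
  have [d1 h] := nbr_sym bo dv0 p01.
  by rewrite arc_revE// arc_srcE.
move=> x [/(arc_sur bo)[v [w [dv wv ->]]]].
have [dw vw] := nbr_sym bo dv wv.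
by rewrite arc_srcE// arc_revE// arc_srcE// => -> ->.
Qed.

(** The vertex of the map at the end of the path coded by [u], with its
    children in clockwise order, starting after the parent. At the root vertex
    the list starts with the root edge. *)
Fixpoint unfolding (u : seq nat) : int * seq int :=
  if u is j :: u' then
    let w := nth 0 (unfolding u').2 j in
    (w, behead (seq.rot (index (unfolding u').1 (nbr w)) (nbr w)))
  else (v0, seq.rot (index (phi b 1) (nbr v0)) (nbr v0)).

Definition uvert u := (unfolding u).1.
Definition uchild u := (unfolding u).2.
Definition walk_tree (u : seq nat) : nat := size (uchild u).

Notation V := uvert.
Notation C := uchild.

(** All the neighbors in clockwise order, from the parent if there is one. A
    cyclic rotation of [nbr] (see [unfoldingP]). *)
Definition ucycle u := if u is j :: u' then V u' :: C u else C u.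

Lemma uchildE j u : C (j :: u) = behead (seq.rot (index (V u) (nbr (V (j :: u)))) (nbr (V (j :: u)))).
Proof. by []. Qed.

Lemma uvertE j u : V (j :: u) = nth 0 (C u) j.
Proof. by []. Qed.

Lemma unfoldingP u : in_tree walk_tree u ->
  downstep b (V u) /\ (exists n, ucycle u = seq.rot n (nbr (V u))).
Proof.
elim: u => [|j u IH] /=; first by move=> _; split=> //; eexists; reflexivity.
move=> /andP[ju /IH[du [n cu]]].
have cn : V (j :: u) \in nbr (V u).
  rewrite uvertE -(mem_rot n) -cu.
  have : nth 0 (C u) j \in C u by rewrite mem_nth.
  by case: (u) => //= *; rewrite inE; apply/orP; right.
have [dw uw] := nbr_sym bo du cn.
split=> //; exists (index (V u) (nbr (V (j :: u)))).
by rewrite uchildE rot_index.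
Qed.

Lemma uvert_down u : in_tree walk_tree u -> downstep b (V u).
Proof. by case/unfoldingP. Qed.

Lemma mem_ucycle u w : in_tree walk_tree u -> (w \in ucycle u) = (w \in nbr (V u)).
Proof. by move=> /unfoldingP[_ [n ->]]; rewrite mem_rot. Qed.

Lemma uniq_ucycle u : in_tree walk_tree u -> uniq (ucycle u).
Proof. by move=> /unfoldingP[dv [n ->]]; rewrite rot_uniq; exact: nbr_uniq. Qed.

Lemma prev_ucycle u w : in_tree walk_tree u -> prev (ucycle u) w = prev (nbr (V u)) w.
Proof.
by move=> /unfoldingP[dv [n ->]]; rewrite prev_rot//; exact: nbr_uniq.
Qed.

Lemma uchild_cycle u : {subset C u <= ucycle u}.
Proof. by case: u => // j u w wC; rewrite inE wC orbT. Qed.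

Lemma uchild_uniq u : in_tree walk_tree u -> uniq (C u).
Proof. by move/uniq_ucycle; case: u => // j u /andP[]. Qed.

Lemma uvert_nbr j u : in_tree walk_tree (j :: u) -> V (j :: u) \in nbr (V u).
Proof.
case/andP => ju ut; rewrite -mem_ucycle//; apply: uchild_cycle.
by rewrite uvertE mem_nth.
Qed.

Lemma uvert_parent j u : in_tree walk_tree (j :: u) -> V u \in nbr (V (j :: u)).
Proof.
move=> ut; have := uvert_nbr ut; case/andP: ut => _ ut h.
by have [] := nbr_sym bo (uvert_down ut) h.
Qed.

(** The spine of the tree. *)
Definition ancestor (n : nat) := iter n (successor b) v0.

Lemma ancestor_down n : downstep b (ancestor n).
Proof. by elim: n => //= n IH; have [] := succP bo IH. Qed.

Lemma ancestor_lt n m : (n < m)%N -> ancestor n < ancestor m.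
Proof.
elim: m => // m IH; rewrite ltnS leq_eqVlt => /orP[/eqP->|/IH h].
  by have [] := succP bo (ancestor_down m).
by apply: lt_trans h _; have [] := succP bo (ancestor_down m).
Qed.

Lemma ancestor_inj n m : ancestor n = ancestor m -> n = m.
Proof. by case: (ltngtP n m) => // /ancestor_lt + e; rewrite e ltxx. Qed.

(** A path follows the spine or leaves it for a predecessor. From then on its
    parent is its successor, so it only takes predecessors. It does not meet
    the spine again: the predecessor of a spine vertex that is on the spine is
    the parent of this vertex, hence none of its children. *)
Lemma uvert_case u : in_tree walk_tree u ->
  (V u = ancestor (size u) /\ (u <> [::] -> V (behead u) = ancestor (size u).-1)) \/
  (exists j u', [/\ u = j :: u', V u' = successor b (V u) & forall n, V u <> ancestor n]).
Proof.
elim: u => [|j u IH]; first by left.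
move=> ju; have ut : in_tree walk_tree u by case/andP: ju.
have du := uvert_down ut; have dj := uvert_down ju; have jn := uvert_nbr ju.
have jC : V (j :: u) \in C u by rewrite uvertE mem_nth//; case/andP: ju.
have [ej|[sj _]] := nbrP bo du jn; case: (IH ut) => [[eu pu]|[i [u' [euu eu nu]]]].
- by left; rewrite ej eu.
- exfalso; have := uniq_ucycle ut; move: jC; rewrite ej euu /= -euu => jC /andP[+ _].
  by rewrite eu jC.
- right; exists j, u; split=> // n en.
  have sE : ancestor n.+1 = ancestor (size u) by rewrite -eu -sj en.
  move/ancestor_inj: sE => nE.
  case: u nE pu ut ju jC {IH eu du dj jn sj} en => // i u [nE] pu ut ju jC en.
  have := uniq_ucycle ut; rewrite /ucycle => /andP[+ _].
  by have /= -> := pu ltac:(discriminate); rewrite -nE -en jC.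
- right; exists j, u; split=> // n en.
  by apply: (nu n.+1); rewrite /= -en.
Qed.

(** Two paths with the same end are both on the spine or both off the spine.
    In the first case they have the same length and their previous vertices
    are on the spine; in the second case the previous vertex is the successor
    of the end. *)
Lemma uvert_inj u u' : in_tree walk_tree u -> in_tree walk_tree u' -> V u = V u' -> u = u'.
Proof.
have root j v : in_tree walk_tree (j :: v) -> V (j :: v) <> ancestor 0.
  by move=> /uvert_case[[-> _] /ancestor_inj|[_ [_ [_ _ /(_ 0%N)]]]].
elim: u u' => [|j v IH] [|j' v'] //.
- by move=> _ /root + e; rewrite -e => /(_ erefl).
- by move=> /root + _ e; rewrite e => /(_ erefl).
move=> ut ut' e.
have vt : in_tree walk_tree v by case/andP: ut.
have vt' : in_tree walk_tree v' by case/andP: ut'.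
have ev : V v = V v'.
  case: (uvert_case ut) => [[su pu]|[_ [_ [[_ <-] pu nu]]]];
    case: (uvert_case ut') => [[su' pu']|[_ [_ [[_ <-] pu' nu']]]].
  - rewrite (pu ltac:(discriminate)) (pu' ltac:(discriminate)).
    by rewrite (@ancestor_inj (size (j :: v)) (size (j' :: v')))// -su -su'.
  - by case: (nu' (size (j :: v))); rewrite -su.
  - by case: (nu (size (j' :: v'))); rewrite -su'.
  - by rewrite pu pu' e.
have {}ev := IH _ vt vt' ev; subst v'; congr cons.
have cu := uchild_uniq vt.
case/andP: ut => ju _; case/andP: ut' => ju' _.
by apply/eqP; rewrite -(nth_uniq 0 ju ju' cu) -!uvertE e.
Qed.

Lemma uvert_nbr_sur u w : in_tree walk_tree u -> w \in nbr (V u) ->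
  (exists j v, [/\ u = j :: v & w = V v]) \/
  (exists2 j, in_tree walk_tree (j :: u) & w = V (j :: u)).
Proof.
move=> ut; rewrite -mem_ucycle// => wu.
have [wC|wC] := boolP (w \in C u).
  right; exists (index w (C u)); last by rewrite uvertE nth_index.
  by rewrite /= ut andbT index_mem.
left; case: u wu wC {ut} => [|j v] /=; first by move=> ->.
by rewrite inE => /orP[/eqP -> _|-> //]; exists j, v.
Qed.

Lemma iter_succ i n : downstep b i -> let s := iter n (successor b) i in
  [/\ downstep b s, i <= s, b s = b i - n%:Z &
      forall k, i <= k <= s -> b i - n%:Z <= b k].
Proof.
move=> di; elim: n => [|n [d1 l1 e1 h1]].
  by split=> //=; rewrite ?subr0// => k; rewrite -eq_le => /eqP ->; exact: lexx.
rewrite /=; set s := iter n _ _ in d1 l1 e1 h1 *.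
have [d2 l2 e2 h2] := succP bo d1.
have nE : b i - n.+1%:Z = b i - n%:Z - 1 by lia.
split=> //; [exact: le_trans l1 (ltW d2)|by rewrite l2 e1 nE|].
move=> k /andP[k1 k2]; rewrite nE; have [ks|sk] := leP k s.
  by apply: le_trans (h1 k _); [rewrite gerDl|rewrite k1].
by rewrite -e1; apply: h2; rewrite (ltW sk).
Qed.

Lemma walk_lower j n : b j - n%:Z <= b (j - n%:Z).
Proof.
elim: n => [|n IH]; first by rewrite !subr0.
have e : j - n.+1%:Z + 1 = j - n%:Z by lia.
have [] := proj1 bo (j - n.+1%:Z); rewrite e => h; move: IH; rewrite h; lia.
Qed.

Lemma succ_reach i s : downstep b i -> downstep b s -> i <= s ->
  (forall k, i <= k <= s -> b s <= b k) -> exists n, iter n (successor b) i = s.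
Proof.
suff H : forall n i, s - i <= n%:Z -> downstep b i -> downstep b s -> i <= s ->
    (forall k, i <= k <= s -> b s <= b k) -> exists n, iter n (successor b) i = s.
  by apply: (H (absz (s - i))); lia.
elim=> [|n IH] {}i hn di ds is_ low; first by exists 0%N; rewrite /=; lia.
have [->|ne] := eqVneq i s; first by exists 0%N.
have [lt1 e1 d1 _] := succP bo di.
have [_ e2 _ low2] := phiP bo (i + 1); rewrite -succE// in e2 low2.
move: (di) => /eqP ei; rewrite ei in e2 low2.
set t := successor b i in lt1 e1 d1 e2 low2 *.
have ts : t <= s.
  rewrite leNgt; apply/negP => st.
  have h1 : b i - 1 <= b (s + 1) by apply: low2; lia.
  have h2 : b s <= b (i + 1) by apply: low; lia.
  by move: ds => /eqP ds; rewrite ds in h1; rewrite ei in h2; lia.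
have [|k hk|m <-] := IH t _ d1 ds ts; first by lia.
  by apply: low; lia.
by exists m.+1; rewrite iterSr.
Qed.

(** An iterated successor of [j] at a level below the walk on [[i, j]] is an
    iterated successor of [i] too, by [succ_reach]. As the walk moves by one
    unit at each step, [j - i] iterations go low enough. *)
Lemma succ_conn i j : downstep b i -> downstep b j -> i <= j ->
  exists n m, iter n (successor b) i = iter m (successor b) j.
Proof.
move=> di dj ij; have [d1 l1 e1 h1] := iter_succ (absz (j - i)) dj.
set s := iter _ _ _ in d1 l1 e1 h1.
have [|k hk|n en] := succ_reach di d1; first exact: le_trans l1.
  rewrite e1; have [jk|kj] := leP j k; first by apply: h1; lia.
  have := walk_lower j (absz (j - k)).
  rewrite (_ : j - (absz (j - k))%:Z = k); last by lia.
  by apply: le_trans; lia.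
by exists n, (absz (j - i)).
Qed.

(** A common iterated successor of [w] and of the root vertex is on the spine,
    and [w] is reached from it through predecessors. *)
Lemma uvert_sur w : downstep b w -> exists2 u, in_tree walk_tree u & V u = w.
Proof.
have step u w' : in_tree walk_tree u -> w' \in nbr (V u) ->
    exists2 u, in_tree walk_tree u & V u = w'.
  move=> ut /(uvert_nbr_sur ut)[[j [v [e ->]]]|[j jt ->]]; last by exists (j :: u).
  by exists v => //; move: ut; rewrite e => /andP[].
have sps n : exists2 u, in_tree walk_tree u & V u = ancestor n.
  elim: n => [|n [u ut e]]; first by exists [::].
  by apply: (step u) => //; rewrite e inE eqxx.
have back n w' : downstep b w' -> (exists2 u, in_tree walk_tree u & V u = iter n (successor b) w') ->
    exists2 u, in_tree walk_tree u & V u = w'.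
  elim: n w' => [|n IH] w' dw' //; rewrite iterSr => h.
  have [_ _ ds _] := succP bo dw'; have [u ut e] := IH _ ds h.
  by apply: (step u) => //; rewrite e inE; apply/orP; right; apply/(predsP bo).
move=> dw.
have [n [m e]] : exists n m, iter n (successor b) w = ancestor m.
  have [h|h] := leP w v0; first exact: succ_conn.
  by have [n [m e]] := succ_conn dv0 dw (ltW h); exists m, n.
by apply: (back n) => //; rewrite e; exact: sps.
Qed.

Definition udart (x : seq nat * bool) : int * bool :=
  if x.2 then arc (V x.1) (V (behead x.1)) else arc (V (behead x.1)) (V x.1).

Lemma walk_tree_gt0 : (0 < walk_tree [::])%N.
Proof. by rewrite /walk_tree /uchild /= size_rot. Qed.

(** Both rotations go one step back in [ucycle]: from the parent to the last
    child, from a child to the previous one, from the first child to the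
    parent, or to the last child at the root vertex. *)
Lemma udart_rot x : in_tree walk_tree x.1 -> x.1 <> [::] ->
  arc_rot b (udart x) = udart (tree_rot walk_tree x).
Proof.
case: x => u [] ut u0; rewrite /= in ut u0.
- rewrite tree_rot_up /udart [(u, true).2]/= [(u, true).1]/=.
  case: u ut u0 => // i u ut _; have it := ut; rewrite [behead _]/=.
  have du := uvert_down ut; have pu := uvert_parent ut.
  rewrite arc_rotP// -prev_ucycle// prev_nth mem_ucycle// pu /=.
  have nC : V u \notin C (i :: u) by have /andP[] := uniq_ucycle ut.
  rewrite (memNindex nC) nth_last /= -/(walk_tree (i :: u)).
  rewrite (last_nth 0) -/(walk_tree (i :: u)).
  by case: (walk_tree (i :: u)).
case: u ut u0 => // j u jt _; have ut : in_tree walk_tree u by case/andP: jt.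
rewrite /udart [(_, false).2]/= [(_, false).1]/= [behead _]/=.
have du := uvert_down ut; have cu := uvert_nbr jt.
have ju : (j < size (C u))%N by case/andP: jt.
rewrite arc_rotP// -prev_ucycle// prev_nth mem_ucycle// cu.
have ix : index (V (j :: u)) (C u) = j.
  by rewrite uvertE index_uniq//; exact: uchild_uniq.
case: u ut du cu ju ix {jt} => [|i u] ut du cu ju ix.
  rewrite /=; case E : (C [::]) ju => [//|y l] ju; rewrite -E.
  have iE : index (V [:: j]) l = if j is j'.+1 then j' else size l.
    have := uchild_uniq ut; rewrite E => /andP[yl _].
    move: ix; rewrite E /=; case: eqP => [ey|ne] jE.
      by rewrite -ey -jE memNindex.
    by move: (index (V [:: j]) l) jE => q <-.
  rewrite E iE; case: j ju ix iE {cu} => [|j] ju ix iE /=.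
    rewrite -[size l]/(size (y :: l)).-1 nth_last /=.
    by rewrite uvertE E (last_nth 0) /walk_tree E.
  rewrite uvertE E; congr arc; apply: set_nth_default; exact: ltnW.
rewrite /= ix; case: j ju ix {cu} => [|j] ju ix //=.
by rewrite uvertE; congr arc; apply: set_nth_default; exact: ltnW.
Qed.

Lemma uihpq0_iso : map_iso (tree_premap walk_tree) (uihpq0_premap b).
Proof.
have dartP (x : dart (tree_premap walk_tree)) : dset (tree_premap walk_tree) x ->
    exists j u, x.1 = j :: u /\ in_tree walk_tree (j :: u).
  by move=> /tree_dsetE; case: x => -[|j u] c [] //= h _; exists j, u.
have adj j u : in_tree walk_tree (j :: u) -> [/\ downstep b (V u), downstep b (V (j :: u)),
    V u \in nbr (V (j :: u)) & V (j :: u) \in nbr (V u)].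
  move=> jt; have ut : in_tree walk_tree u by case/andP: jt.
  by split; [exact: uvert_down|exact: uvert_down|exact: uvert_parent|exact: uvert_nbr].
exists V, udart; split.
- split=> [u ut|u v /set_mem ut /set_mem vt|w /uvert_sur[u ut <-]]; last by exists u.
    exact: uvert_down.
  exact: uvert_inj.
- split.
  + move=> x mx; have [j [u [e jt]]] := dartP x mx; have [d1 d2 n1 n2] := adj _ _ jt.
    by rewrite /udart e; case: (x.2); apply: arc_down.
  + move=> x y /set_mem mx /set_mem my; have [j [u [e jt]]] := dartP x mx.
    have [i [v [f it]]] := dartP y my.
    have [d1 d2 n1 n2] := adj _ _ jt; have [d3 d4 n3 n4] := adj _ _ it.
    have ut : in_tree walk_tree u by case/andP: (jt).
    have vt : in_tree walk_tree v by case/andP: (it).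
    case: x y {mx my} e f => [_ c] [_ c'] /= -> ->; rewrite /udart /=.
    case: c; case: c' => /arc_inj => /(_ bo) h.
    * by have [] := h d2 n1 d4 n3 => /(uvert_inj jt it) ->.
    * have [] := h d2 n1 d3 n4 => /(uvert_inj jt vt) e1 /(uvert_inj ut it) e2.
      by have := congr1 size e2; rewrite -e1 /= => es; exfalso; clear -es; lia.
    * have [] := h d1 n2 d4 n3 => /(uvert_inj ut it) e1 /(uvert_inj jt vt) e2.
      by have := congr1 size e1; rewrite -e2 /= => es; exfalso; clear -es; lia.
    * by have [] := h d1 n2 d3 n4 => _ /(uvert_inj jt it) ->.
  + move=> x /(arc_sur bo)[v [w [dv wv ->]]]; have [u ut eu] := uvert_sur dv.
    subst v; case: (uvert_nbr_sur ut wv) => [[j [v [e ->]]]|[j jt ->]].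
      exists (u, true); first by apply/tree_dsetE; rewrite e in ut *.
      by rewrite /udart /= e.
    by exists (j :: u, false); first exact/tree_dsetE.
- move=> x mx; have [j [u [e jt]]] := dartP x mx; have [d1 d2 n1 n2] := adj _ _ jt.
  split.
  + by case: x mx e => a [] mx /= e; rewrite e /udart /= arc_srcE.
  + by case: x mx e => a [] mx /= e; rewrite e /udart /= arc_revE.
  + apply: udart_rot; first by rewrite e.
    by rewrite e.
- rewrite -[LHS]/(arc v0 (nth 0 (seq.rot (index (phi b 1) (nbr v0)) (nbr v0)) 0)).
  by rewrite rot_index ?phi01// -[RHS]/(arc_root b) arc_rootE.
Qed.

Lemma uihpq0_open (R : realType) (A : set rmap) : dmap_open R A ->
  A (uihpq0 b) <-> A (tree_map walk_tree).
Proof.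
move=> Ao; have iso := uihpq0_iso; have k0 := walk_tree_gt0.
have mP := tree_is_map k0; have mP' := is_map_iso mP iso.
have e1 : premap_of (uihpq0 b) = uihpq0_premap b.
  rewrite /uihpq0; case: asboolP => // _; rewrite /to_rmap.
  by case: pselect.
have e2 := tree_mapE k0.
split; apply: (dmap_open_iso Ao); rewrite e1 e2//.
by apply: map_iso_sym => //; exact: is_map_dclosed.
Qed.

End Unfold.

(** * Finite parts of trees *)

Fixpoint forest_code (f : forest) : GenTree.tree nat :=
  if f is FCons c s then GenTree.Node 0 [:: forest_code c; forest_code s]
  else GenTree.Leaf 0%N.

Fixpoint forest_decode (t : GenTree.tree nat) : forest :=
  if t is GenTree.Node _ [:: c; s] then FCons (forest_decode c) (forest_decode s)
  else FNil.

Lemma forest_codeK : cancel forest_code forest_decode.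
Proof. by elim=> //= c -> s ->. Qed.

HB.instance Definition _ := Countable.copy forest (can_type forest_codeK).

Fixpoint fapp (f g : forest) : forest := if f is FCons c s then FCons c (fapp s g) else g.

Lemma nb_nodes_app f g : nb_nodes (fapp f g) = (nb_nodes f + nb_nodes g)%N.
Proof. by elim: f => //= c _ s ->; rewrite addnA. Qed.

Lemma left_end_app x f g : left_end x (fapp f g) = left_end (left_end x f) g.
Proof. by rewrite /left_end nb_nodes_app; lia. Qed.

Lemma left_end_cons x c s : left_end x (FCons c s) = left_end (left_end x c - 2) s.
Proof. by rewrite /left_end /=; lia. Qed.

Lemma root_pos_app x f g : root_pos x (fapp f g) = root_pos x f ++ root_pos (left_end x f) g.
Proof.
elim: f x => [|c _ s IH] x /=; first by rewrite /left_end /= muln0 subr0.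
by rewrite IH left_end_cons.
Qed.

Lemma reads_app b x f g : reads b x (fapp f g) <-> reads b x f /\ reads b (left_end x f) g.
Proof.
elim: f x => [|c _ s IH] x /=; first by rewrite /left_end /= muln0 subr0; split=> [|[]].
split=> [[h1 h2 h3 /IH[h4 h5]]|[[h1 h2 h3 h4] h5]].
  by rewrite left_end_cons.
by split=> //; apply/IH; rewrite -left_end_cons.
Qed.

Lemma fapp_last f : f = FNil \/ exists a t, f = fapp a (FCons t FNil).
Proof.
elim: f => [|c _ s [->|[a [t ->]]]]; [by left|right; by exists FNil, c|right].
by exists (FCons c a), t.
Qed.

(** The children of [u] from rank [j] on carry the trees of [f], their first
    [nb_trees f] ones. *)
Fixpoint kforest (k : seq nat -> nat) (u : seq nat) (j : nat) (f : forest) : Prop :=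
  if f is FCons c s then
    [/\ k (j :: u) = nb_trees c, kforest k (j :: u) 0 c & kforest k u j.+1 s]
  else True.

(** The [n]-th pair consists of the trees carried by the children of the
    [n]-th spine vertex, before and after the next spine vertex in the order
    of ranks. *)
Definition config := seq (forest * forest).

(** The number of vertices, including those of the spine. *)
Definition config_size (c : config) : nat := \sum_(p <- c) (nb_nodes p.1 + nb_nodes p.2).+1.

Fixpoint tree_match (k : seq nat -> nat) (u : seq nat) (c : config) : Prop :=
  if c is (f, g) :: c' then
    [/\ k u = (nb_trees f + nb_trees g).+1, kforest k u 0 f, kforest k u (nb_trees f).+1 g
      & tree_match k (nb_trees f :: u) c']
  else True.

Fixpoint var_match (x : seq nat -> nat) (s : nat -> nat * nat) (u : seq nat) (c : config) : Prop :=
  if c is (f, g) :: c' then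
    [/\ s (size u) = ((nb_trees f + nb_trees g).+1, nb_trees f), kforest x u 0 f,
        kforest x u (nb_trees f).+1 g & var_match x s (nb_trees f :: u) c']
  else True.

Lemma in_tree_suffix k w v : in_tree k (w ++ v) -> in_tree k v.
Proof. by elim: w => // i w IH /= /andP[_ /IH]. Qed.

Lemma kforest_agree k k' u j f w i : kforest k u j f -> kforest k' u j f ->
  in_tree k (w ++ i :: u) -> (j <= i < j + nb_trees f)%N -> k (w ++ i :: u) = k' (w ++ i :: u).
Proof.
elim: f u j w i => [|c IHc s IHs] u j w i /=; first by lia.
move=> [e1 c1 s1] [e2 c2 s2] wt hi.
have [ij|ij] := eqVneq i j; last by apply: (IHs _ j.+1) => //; lia.
subst i; case/lastP: w wt => [|w i] wt; first by rewrite /= e1 e2.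
rewrite cat_rcons in wt *; apply: (IHc _ 0%N) => //.
by have /= /andP[] := in_tree_suffix wt; rewrite e1 add0n.
Qed.

(** A path shorter than the spine of [c] either stays on the spine or leaves
    it for one of the forests of [c], and the numbers of children are
    prescribed in both cases. *)
Lemma tree_match_agree k k' u c w : tree_match k u c -> tree_match k' u c ->
  in_tree k (w ++ u) -> (size w < size c)%N -> k (w ++ u) = k' (w ++ u).
Proof.
elim: c u w => [|[f g] c IH] u w //= [e1 f1 g1 t1] [e2 f2 g2 t2] wt.
case/lastP: w wt => [|w i] wt; first by rewrite /= e1 e2.
rewrite cat_rcons size_rcons ltnS in wt * => ws.
have := in_tree_suffix wt; rewrite /= e1 => /andP[hi _].
have [fi|fi] := ltnP i (nb_trees f); first exact: (kforest_agree f1 f2).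
have [e|ne] := eqVneq i (nb_trees f); first by rewrite e in wt *; exact: IH.
by apply: (kforest_agree g1 g2) => //; lia.
Qed.

Lemma tree_match_depth k k' c : tree_match k [::] c -> tree_match k' [::] c -> agree (size c) k k'.
Proof.
move=> h h' u ut uc.
by have := @tree_match_agree k k' [::] c u h h'; rewrite cats0; apply.
Qed.

Lemma kforest_uniq k u j f f' : kforest k u j f -> kforest k u j f' ->
  nb_trees f = nb_trees f' -> f = f'.
Proof.
elim: f u j f' => [|c IHc s IHs] u j [|c' s'] //= [e1 c1 s1] [e2 c2 s2] [e].
congr FCons; [apply: (IHc _ _ _ c1 c2)|apply: (IHs _ _ _ s1 s2)] => //.
by rewrite -e1.
Qed.

(** The variables of the spine give the numbers of trees in both forests, and
    the numbers of children give the trees. *)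
Lemma var_match_uniq x s u c c' : var_match x s u c -> var_match x s u c' ->
  size c = size c' -> c = c'.
Proof.
elim: c u c' => [|[f g] c IH] u [|[f' g'] c'] //= [e1 f1 g1 t1] [e2 f2 g2 t2] [e].
move: e2; rewrite e1 => -[e3 e4].
have ff := kforest_uniq f1 f2 e4; subst f'.
have gg : g = g' by apply: (kforest_uniq g1 g2); lia.
by subst g'; congr cons; exact: IH t1 t2 e.
Qed.

(** A word that has left the spine does not return to it, and its number of
    children in [kesten_offspring] is given by [x]. *)
Lemma kforest_kesten x s u j f : kforest x u j f ->
  (forall i, (j <= i < j + nb_trees f)%N -> i :: u <> spine (fun n => (s n).2) (size u).+1) ->
  kforest (kesten_offspring x s) u j f.
Proof.
elim: f u j => [|c IHc f IHf] u j //= [e c1 f1] off.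
have offj : j :: u <> spine (fun n => (s n).2) (size (j :: u)) by apply: off; lia.
split.
- by rewrite /kesten_offspring; case: eqP.
- by apply: IHc => // i _ ei; apply: offj; exact: (congr1 behead ei).
- by apply: IHf => // i hi; apply: off; lia.
Qed.

Lemma var_match_tree_match x s u c : u = spine (fun n => (s n).2) (size u) ->
  var_match x s u c -> tree_match (kesten_offspring x s) u c.
Proof.
elim: c u => [|[f g] c IH] u //= us [e f1 g1 t1]; split.
- by rewrite /kesten_offspring -us eqxx e.
- by apply: kforest_kesten => // i hi; rewrite /= e => -[]; lia.
- by apply: kforest_kesten => // i hi; rewrite /= e => -[]; lia.
- by apply: IH => //=; rewrite e -us.
Qed.

Fixpoint nodes (u : seq nat) (j : nat) (f : forest) : seq (seq nat) :=
  if f is FCons c s then (j :: u) :: nodes (j :: u) 0 c ++ nodes u j.+1 s else [::].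

(** The words off the spine at which a configuration prescribes the number of
    children. *)
Fixpoint cnodes (u : seq nat) (c : config) : seq (seq nat) :=
  if c is (f, g) :: c' then
    nodes u 0 f ++ nodes u (nb_trees f).+1 g ++ cnodes (nb_trees f :: u) c' else [::].

Lemma nodesP u j f v : v \in nodes u j f ->
  exists w i, v = w ++ i :: u /\ (j <= i < j + nb_trees f)%N.
Proof.
elim: f u j v => [|c IHc s IHs] u j v //=.
rewrite inE mem_cat => /or3P[/eqP ->|/IHc[w [i [-> hi]]]|/IHs[w [i [-> hi]]]].
- by exists [::], j; split=> //; lia.
- by exists (rcons w i), j; rewrite cat_rcons; split=> //; lia.
- by exists w, i; split=> //; lia.
Qed.

(** The words that leave [u] by different children are different; this
    separates the parts of a configuration. *)
Lemma suffix_inj (w w' : seq nat) i i' u : w ++ i :: u = w' ++ i' :: u -> i = i'.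
Proof.
move=> e; have sw : size w = size w'.
  by have := congr1 size e; rewrite !size_cat /=; lia.
by have /eqP := e; rewrite eqseq_cat// => /andP[_ /eqP[]].
Qed.

Lemma cnodesP u c v : v \in cnodes u c -> exists w i, v = w ++ i :: u.
Proof.
elim: c u v => [|[f g] c IH] u v //=.
rewrite !mem_cat => /or3P[/nodesP[w [i [-> _]]]|/nodesP[w [i [-> _]]]|/IH[w [i ->]]].
- by exists w, i.
- by exists w, i.
- by exists (rcons w i), (nb_trees f); rewrite cat_rcons.
Qed.

Lemma nodes_uniq u j f : uniq (nodes u j f).
Proof.
elim: f u j => [|c IHc s IHs] u j //=; rewrite cat_uniq IHc IHs andbT /=.
apply/andP; split.
  rewrite mem_cat; apply/norP; split; apply/negP => /nodesP[w [i [e hi]]].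
    by have := congr1 size e; rewrite !size_cat /=; lia.
  by have := @suffix_inj [::] w j i u e; lia.
apply/hasPn => v /nodesP[w [i [-> hi]]]; apply/negP => /nodesP[w' [i' [e hi']]].
by have := @suffix_inj w (rcons w' i') i j u; rewrite cat_rcons e => /(_ erefl); lia.
Qed.

Lemma cnodes_uniq u c : uniq (cnodes u c).
Proof.
elim: c u => [|[f g] c IH] u //=; rewrite !cat_uniq !nodes_uniq IH /= andbT.
apply/andP; split; apply/hasPn => v.
  rewrite mem_cat => /orP[/nodesP[w [i [-> hi]]]|/cnodesP[w [i ->]]];
    apply/negP => /nodesP[w' [i' [e hi']]].
    by have := suffix_inj e; lia.
  by have := @suffix_inj (rcons w i) w' (nb_trees f) i' u; rewrite cat_rcons => /(_ e); lia.
move=> /cnodesP[w [i ->]]; apply/negP => /nodesP[w' [i' [e hi']]].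
by have := @suffix_inj (rcons w i) w' (nb_trees f) i' u; rewrite cat_rcons => /(_ e); lia.
Qed.

Lemma kforest_nodes k x u j f : kforest k u j f -> {in nodes u j f, x =1 k} ->
  kforest x u j f.
Proof.
elim: f u j => [|c IHc s IHs] u j //= [e c1 s1] xk; split.
- by rewrite xk// inE eqxx.
- by apply: IHc => // v vc; apply: xk; rewrite inE mem_cat vc orbT.
- by apply: IHs => // v vc; apply: xk; rewrite inE mem_cat vc !orbT.
Qed.

Definition spine_level (p : forest * forest) : nat * nat := ((nb_trees p.1 + nb_trees p.2).+1, nb_trees p.1).

Lemma tree_match_var_match k x s u c : tree_match k u c -> {in cnodes u c, x =1 k} ->
  (forall n, (n < size c)%N -> s (size u + n)%N = spine_level (nth (FNil, FNil) c n)) ->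
  var_match x s u c.
Proof.
elim: c u => [|[f g] c IH] u //= [e f1 g1 t1] xk sk; split.
- by have := sk 0%N isT; rewrite addn0.
- by apply: kforest_nodes f1 _ => v vf; apply: xk; rewrite mem_cat vf.
- by apply: kforest_nodes g1 _ => v vf; apply: xk; rewrite !mem_cat vf orbT.
- apply: IH => // [v vc|n nc]; first by apply: xk; rewrite !mem_cat vc !orbT.
  by have := sk n.+1 nc; rewrite /= addnS addSn.
Qed.

(** Every vertex of a forest is the root of one of its trees or a child of one
    of its vertices. *)
Lemma nodes_sum k u j f : kforest k u j f ->
  (\sum_(v <- nodes u j f) (k v).+1 + nb_trees f = 2 * nb_nodes f)%N.
Proof.
elim: f u j => [|c IHc s IHs] u j /=; first by rewrite big_nil.
move=> [e /IHc h1 /IHs h2]; rewrite big_cons big_cat /= e; lia.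
Qed.

(** There are as many children as vertices: all vertices are children, except
    for the root vertex, but the spine vertex that follows the last one of the
    configuration is counted as a child. *)
Lemma cnodes_sum k u c : tree_match k u c ->
  (\sum_(v <- cnodes u c) (k v).+1 + \sum_(p <- c) ((spine_level p).1).+1 = 2 * config_size c)%N.
Proof.
elim: c u => [|[f g] c IH] u /=; first by rewrite /config_size !big_nil.
move=> [e /nodes_sum h1 /nodes_sum h2 /IH].
rewrite /config_size !big_cat !big_cons /=; lia.
Qed.

(** * Finite parts read in a walk *)

(** The steps from [z] to [s] have been read. The next spine vertex is the
    down-step [s'], and its descendants on both sides of what has been read
    are those of [g] on the right and those of [f] on the left, up to the
    up-step [z'] that starts the excursion ended by [s']. *)
Fixpoint wlevels (b : int -> int) (s z : int) (c : config) : Prop :=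
  if c is (f, g) :: c' then
    let s' := s + 1 + (2 * nb_nodes g)%:Z in let z' := left_end z f - 1 in
    [/\ reads b s' g, downstep b s', reads b z f, upstep b z' & wlevels b s' z' c']
  else True.

(** At the root vertex, ranks are counted clockwise from the root edge, while
    [wlevels] has the predecessors before time 0 and after time 0 apart. If
    the root edge leads to the successor, all the predecessors are before time
    0. Otherwise it leads to the first predecessor after time 0, which is the
    last of the forest read from the root vertex; then come the predecessors
    before time 0, the successor, and the other predecessors after time 0. *)
Definition untwist (p : forest * forest) : forest * forest :=
  if p.1 is FCons t f then (f, fapp p.2 (FCons t FNil)) else (p.2, FNil).

Definition wconfig (c : config) : config := if c is p :: c' then untwist p :: c' else [::].

(** No step has been read at the start, which is the empty interval from 0 to
    -1. *)
Definition walk_match (b : int -> int) (c : config) := wlevels b (- 1) 0 (wconfig c).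

Lemma config_size_wconfig c : config_size (wconfig c) = config_size c.
Proof.
case: c => // -[[|t f] g] c; rewrite /config_size /= !big_cons /=; first by rewrite addn0.
by rewrite nb_nodes_app /=; lia.
Qed.

Lemma wconfig_sur c : exists c', wconfig c' = c.
Proof.
case: c => [|[f g] c]; first by exists [::].
have [->|[a [t ->]]] := fapp_last g; first by exists ((FNil, f) :: c).
by exists ((FCons t f, a) :: c).
Qed.

Lemma size_wconfig c : size (wconfig c) = size c.
Proof. by case: c. Qed.

Definition right_time (s : int) (c : config) : int := s + (\sum_(p <- c) (2 * nb_nodes p.2).+1)%:Z.
Definition left_time (z : int) (c : config) : int := z - (\sum_(p <- c) (2 * nb_nodes p.1).+1)%:Z.

Lemma time_span c : right_time (- 1) c + 1 - left_time 0 c = (2 * config_size c)%:Z.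
Proof.
suff : (\sum_(p <- c) (2 * nb_nodes p.2).+1 + \sum_(p <- c) (2 * nb_nodes p.1).+1 = 2 * config_size c)%N.
  by rewrite /right_time /left_time; lia.
rewrite /config_size -big_split big_distrr /=; apply: eq_bigr => p _; lia.
Qed.

Definition same_step (b b' : int -> int) i :=
  (downstep b i /\ downstep b' i) \/ (upstep b i /\ upstep b' i).

Lemma reads_same b b' x f i : reads b x f -> reads b' x f -> left_end x f <= i < x ->
  same_step b b' i.
Proof.
elim: f x => [|c IHc s IHs] x /=; first by rewrite /left_end /=; lia.
move=> [d1 c1 u1 s1] [d2 c2 u2 s2]; rewrite left_end_cons => hi.
have [h1|h1] := ltP i (left_end x c - 2); first by apply: (IHs (left_end x c - 2)) => //; rewrite h1 andbT; case/andP: hi.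
have [->|h2] := eqVneq i (left_end x c - 2); first by right.
have [->|h3] := eqVneq i (x - 1); first by left.
apply: (IHc (x - 1)) => //; move: h1 h2 h3 hi; rewrite /left_end; lia.
Qed.

Lemma wlevels_same b b' s z c i : wlevels b s z c -> wlevels b' s z c ->
  (left_time z c <= i < z) \/ (s < i <= right_time s c) -> same_step b b' i.
Proof.
elim: c s z => [|[f g] c IH] s z /=.
  rewrite /left_time /right_time !big_nil => _ _ [|]; lia.
set s' := s + 1 + _; move=> [g1 d1 f1 u1 t1] [g2 d2 f2 u2 t2].
have es : right_time s ((f, g) :: c) = right_time s' c by rewrite /right_time /s' big_cons /=; lia.
have ez : left_time z ((f, g) :: c) = left_time (left_end z f - 1) c by rewrite /left_time /left_end big_cons /=; lia.
rewrite es ez => -[/andP[h1 h2]|/andP[h1 h2]].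
  have [k1|k1] := ltP i (left_end z f - 1); first by apply: (IH _ _ t1 t2); left; rewrite h1.
  have [->|ne] := eqVneq i (left_end z f - 1); first by right.
  by apply: (reads_same f1 f2); lia.
have [k1|k1] := ltP s' i; first by apply: (IH _ _ t1 t2); right; rewrite k1.
have [->|ne] := eqVneq i s'; first by left.
apply: (reads_same g1 g2); move: k1 ne; rewrite /left_end /s'; lia.
Qed.

Section WalkConfig.
Variable b : int -> int.
Hypothesis bo : oscillating b.

(** The next spine vertex is [phi b (s + 1)], and the walk does not go below
    its level since [s + 1]. *)
Lemma wlevels_ex r s z : exists c, size c = r /\ wlevels b s z c.
Proof.
elim: r s z => [|r IH] s z; first by exists [::].
have [h1 h2 h3 h4] := phiP bo (s + 1).
have [||g [rg eg]] := forest_between bo h1; first by [].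
  by rewrite h2.
have [f [rf uf]] := forest_ex bo z.
have [c [<- wc]] := IH (phi b (s + 1)) (left_end z f - 1).
exists ((f, g) :: c); split=> //=.
have <- : phi b (s + 1) = s + 1 + (2 * nb_nodes g)%:Z.
  by move: (phi b (s + 1)) eg => q; rewrite /left_end; lia.
by [].
Qed.

Lemma walk_match_ex r : exists c, size c = r /\ walk_match b c.
Proof.
have [c [<- h]] := wlevels_ex r (- 1) 0; have [c' e] := wconfig_sur c.
exists c'; split; first by rewrite -e size_wconfig.
by rewrite /walk_match e.
Qed.

Notation walk_tree := (walk_tree b).
Notation V := (uvert b).
Notation C := (uchild b).

(** Off the spine the parent is the successor, so the children are the
    predecessors, in the order in which the walk reads them. *)
Lemma kforest_walk f u x pre post : in_tree walk_tree u -> reads b x f ->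
  C u = pre ++ root_pos x f ++ post ->
  (forall w, w \in root_pos x f -> downstep b w /\ successor b w = V u) ->
  kforest walk_tree u (size pre) f.
Proof.
elim: f u x pre post => [|c IHc s IHs] u x pre post //= ut [dx rc uc rs] Cu hw.
have [_ sx] := hw (x - 1) (mem_head _ _).
have e : V (size pre :: u) = x - 1 by rewrite uvertE Cu nth_cat ltnn subnn.
have jt : in_tree walk_tree (size pre :: u).
  by rewrite /= ut andbT /walk_tree Cu size_cat /=; lia.
have Cj : C (size pre :: u) = root_pos (x - 1) c.
  rewrite uchildE e /nbr sx /= eqxx rot0 /=.
  rewrite /preds (left_forest_uniq bo rc)// (_ : left_end (x - 1) c - 1 = left_end x c - 2)//.
  by rewrite /left_end; lia.
split.
- by rewrite /walk_tree Cj size_root_pos.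
- apply: (IHc _ (x - 1) [::] [::]) => //; first by rewrite cats0.
  move=> w; rewrite -Cj e => wC; apply/(predsP bo) => //.
  by move: wC; rewrite Cj /preds (left_forest_uniq bo rc)// (_ : left_end (x - 1) c - 1 = left_end x c - 2)// /left_end; lia.
- rewrite -(size_rcons pre (x - 1)); apply: (IHs _ (left_end x c - 2) _ post) => //.
    by rewrite cat_rcons.
  by move=> w ws; apply: hw; rewrite inE ws orbT.
Qed.

Lemma rot_split (T : eqType) (l1 l2 : seq T) x : x \notin l1 ->
  seq.rot (index x (l1 ++ x :: l2)) (l1 ++ x :: l2) = x :: l2 ++ l1.
Proof.
move=> xl; rewrite index_cat (negbTE xl) /= eqxx addn0 rot_size_cat.
by [].
Qed.

(** The spine vertex [s'] has three kinds of descendants, from right to left: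
    those of the forest [g], the previous spine vertex [s] with its own
    descendants [F], and those of the forest [f]. Clockwise from its parent
    [s], the children of [s'] are the roots of [f], then its successor, then
    the roots of [g]. *)
Lemma tree_match_spine c u p s z F : in_tree walk_tree (p :: u) -> V u = s ->
  downstep b s -> V (p :: u) = successor b s -> reads b s F -> left_end s F - 1 = z -> upstep b z ->
  wlevels b s z c -> tree_match walk_tree (p :: u) c.
Proof.
elim: c u p s z F => [|[f g] c IH] u p s z F //= pt eV ds eS rF eF uz.
set s' := s + 1 + _; move=> [rg ds' rf uf wc].
have [lg lowg] := reads_level rg.
have eg : left_end s' g = s + 1 by rewrite /left_end /s'; lia.
rewrite eg in lg lowg.
have ss' : successor b s = s'.
  by rewrite succE//; apply: phi_uniq => //; [rewrite /s'; lia|move=> l hl; rewrite lg; exact: lowg].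
rewrite ss' in eS.
have esF : left_end (s + 1) F - 2 = z by move: eF; rewrite /left_end; lia.
pose F' := fapp g (FCons F f).
have rF' : reads b s' F'.
  apply/reads_app; split=> //; rewrite eg /= addrK; split=> //; rewrite esF//.
have eF' : left_end s' F' = left_end z f by rewrite left_end_app eg left_end_cons esF.
have predsE : preds b s' = root_pos s' g ++ s :: root_pos z f.
  rewrite /preds (left_forest_uniq bo rF'); last by rewrite eF'.
  by rewrite root_pos_app eg /= addrK esF.
have un := nbr_uniq bo ds'.
have Cp : C (p :: u) = root_pos z f ++ successor b s' :: root_pos s' g.
  rewrite uchildE eS eV /nbr predsE -cat_cons rot_split//.
  move: un; rewrite /nbr predsE -cat_cons cat_uniq => /and3P[_ /hasPn h _].
  by apply: h; rewrite inE eqxx.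
have mem_preds w : w \in root_pos z f \/ w \in root_pos s' g -> downstep b w /\ successor b w = V (p :: u).
  by rewrite eS => hw; apply/(predsP bo) => //; rewrite predsE mem_cat inE; case: hw => ->; rewrite ?orbT.
split.
- by rewrite /walk_tree Cp size_cat /= !size_root_pos addnS.
- apply: (kforest_walk (pre := [::])) rf Cp _ => // w hw; apply: mem_preds; by left.
- have := @kforest_walk g (p :: u) s' (rcons (root_pos z f) (successor b s')) [::] pt rg.
  rewrite size_rcons size_root_pos; apply; first by rewrite cats0 cat_rcons.
  by move=> w hw; apply: mem_preds; right.
- apply: (IH _ _ s' (left_end z f - 1) F') => //.
  + apply/andP; split=> //; rewrite /walk_tree Cp size_cat /= !size_root_pos; lia.
  + by rewrite uvertE Cp nth_cat size_root_pos ltnn subnn.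
  + by rewrite eF'.
Qed.

(** Only the root vertex is left to [tree_match_spine], with the two cases of
    [untwist]. *)
Lemma walk_match_tree_match c : walk_match b c -> tree_match walk_tree [::] c.
Proof.
rewrite /walk_match; case: c => [|p c] //=.
case ep : (untwist p) => [f g]; set s' := - 1 + 1 + _; move=> [rg ds' rf uf wc].
have [lg lowg] := reads_level rg.
have eg : left_end s' g = 0 by rewrite /left_end /s'; lia.
rewrite eg in lg lowg.
have s0 : 0 <= s' by rewrite /s'; lia.
have V0 : phi b 0 = s' by apply: phi_uniq => // l hl; rewrite lg; exact: lowg.
pose F' := fapp g f.
have rF' : reads b s' F' by apply/reads_app; rewrite eg.
have eF' : left_end s' F' = left_end 0 f by rewrite left_end_app eg.
have predsE : preds b s' = root_pos s' g ++ root_pos 0 f.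
  by rewrite /preds (left_forest_uniq bo rF') ?eF'// root_pos_app eg.
have un := nbr_uniq bo ds'.
have mem_preds w : w \in preds b s' -> downstep b w /\ successor b w = V [::].
  by rewrite /uvert /= V0 => /(predsP bo _ ds').
have C0 : C [::] = seq.rot (index (phi b 1) (nbr b s')) (nbr b s').
  by rewrite /uchild /= V0.
case: p ep => -[|t f0] g0 [ef e_g]; subst f g.
  have s'0 : s' = 0 by rewrite /s' /=; lia.
  have phi1 : phi b 1 = successor b s' by rewrite (succE bo ds') s'0 add0r.
  have {}C0 : C [::] = successor b s' :: root_pos 0 g0.
    by rewrite C0 phi1 /nbr /= eqxx rot0 predsE.
  have k1 : walk_tree [::] = (nb_trees g0).+1 by rewrite /walk_tree C0 /= size_root_pos.
  split=> //.
    apply: (@kforest_walk g0 [::] 0 [:: successor b s'] [::]) => //; first by rewrite cats0.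
    by move=> w hw; apply: mem_preds; rewrite predsE mem_cat hw orbT.
  apply: (@tree_match_spine _ [::] 0 s' (left_end 0 g0 - 1) F') => //.
  - by rewrite /= k1.
  - by rewrite uvertE C0.
set q := left_end s' g0.
have [rg0 rt] := (reads_app _ _ _ _).1 rg; rewrite -/q in rt.
have [dq rt' ut _] := rt.
have eq : left_end q (FCons t FNil) = 0 by rewrite -eg left_end_app.
have eq' : left_end q t - 2 = 0 by rewrite -eq left_end_cons /left_end /= muln0 subr0.
have u0 : b 1 = b 0 + 1 by move: ut; rewrite eq' /upstep add0r => /eqP.
have [lq lowq] := reads_level rt'.
have eq1 : left_end (q - 1) t = 1 by move: eq'; rewrite /left_end; lia.
rewrite eq1 in lq lowq.
have phi1 : phi b 1 = q - 1.
  apply: phi_uniq => //; first by move: eq1; rewrite /left_end; lia.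
  by move=> l hl; rewrite lq; exact: lowq.
have pgE : root_pos s' (fapp g0 (FCons t FNil)) = rcons (root_pos s' g0) (q - 1).
  by rewrite root_pos_app -/q /= cats1.
have {}C0 : C [::] = (q - 1) :: root_pos 0 f0 ++ successor b s' :: root_pos s' g0.
  rewrite C0 phi1 /nbr predsE pgE cat_rcons -cat_cons rot_split//.
  move: un; rewrite /nbr predsE pgE cat_rcons -cat_cons cat_uniq => /and3P[_ /hasPn h _].
  by apply: h; rewrite inE eqxx.
have k1 : walk_tree [::] = (nb_trees f0 + nb_trees g0).+2.
  by rewrite /walk_tree C0 /= size_cat /= !size_root_pos addnS.
have m1 w : w \in root_pos 0 f0 -> downstep b w /\ successor b w = V [::].
  by move=> hw; apply: mem_preds; rewrite predsE mem_cat hw orbT.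
have m2 w : w \in root_pos s' g0 -> downstep b w /\ successor b w = V [::].
  by move=> hw; apply: mem_preds; rewrite predsE pgE mem_cat mem_rcons inE hw orbT.
have m3 : downstep b (q - 1) /\ successor b (q - 1) = V [::].
  by apply: mem_preds; rewrite predsE pgE mem_cat mem_rcons inE eqxx.
split.
- by rewrite k1.
- have [h1 h2 _] : kforest walk_tree [::] 0 (FCons t FNil).
    apply: (@kforest_walk (FCons t FNil) [::] q [::]) => //; first exact: C0.
    by move=> w; rewrite /= inE => /eqP ->.
  split=> //; apply: (@kforest_walk f0 [::] 0 [:: q - 1]) => //; exact: C0.
- have := @kforest_walk g0 [::] s' ((q - 1) :: rcons (root_pos 0 f0) (successor b s')) [::] isT rg0.
  rewrite /= size_rcons size_root_pos; apply => //.
  by rewrite C0 cats0 /= cat_rcons.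
- apply: (@tree_match_spine _ [::] _ s' (left_end 0 f0 - 1) F') => //.
  + by rewrite /= andbT k1; lia.
  + by rewrite uvertE C0 /= nth_cat size_root_pos ltnn subnn.
  + by rewrite eF'.
Qed.

End WalkConfig.

(** * Events of discrete variables *)

Section Discrete.
Context {d : measure_display} {T : measurableType d}.

Lemma measurable_const (p : Prop) : measurable [set w : T | p].
Proof.
have [h|h] := pselect p.
  by rewrite (_ : [set _ | _] = setT)//; apply/seteqP; split.
by rewrite (_ : [set _ | _] = set0)//; apply/seteqP; split=> // w /h.
Qed.

Lemma measurable_and (P Q : T -> Prop) : measurable [set w | P w] ->
  measurable [set w | Q w] -> measurable [set w | P w /\ Q w].
Proof. exact: measurableI. Qed.

Lemma measurable_exists (I : countType) (P : I -> T -> Prop) :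
  (forall i, measurable [set w | P i w]) -> measurable [set w | exists i, P i w].
Proof.
move=> mP; rewrite (_ : [set _ | _] = \bigcup_i [set w | P i w]).
  by apply: countable_bigcupT_measurable => //; exact: countableP.
by apply/seteqP; split=> w [i h]; [exists i|exists i].
Qed.

Lemma measurable_forall (I : countType) (P : I -> T -> Prop) :
  (forall i, measurable [set w | P i w]) -> measurable [set w | forall i, P i w].
Proof.
move=> mP; rewrite (_ : [set _ | _] = ~` [set w | exists i, ~ P i w]).
  apply: measurableC; apply: measurable_exists => i.
  exact: (measurableC (mP i)).
apply/seteqP; split=> w h; first by move=> [i]; apply.
by move=> i; apply: contrapT => n; apply: h; exists i.
Qed.

Lemma discrete_rv_pair (I J : countType) (X : T -> I) (Y : T -> J) :
  discrete_rv X -> discrete_rv Y -> discrete_rv (fun w => (X w, Y w)).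
Proof.
move=> mX mY B; rewrite (_ : _ @^-1` B =
    [set w | exists p : I * J, B p /\ (X w = p.1 /\ Y w = p.2)]).
  apply: measurable_exists => p; apply: measurable_and; first exact: measurable_const.
  by apply: measurable_and; [exact: (mX [set p.1])|exact: (mY [set p.2])].
apply/seteqP; split=> w /=; first by move=> h; exists (X w, Y w).
by move=> [[i j] /= [h [-> ->]]].
Qed.

Lemma discrete_rv_rel (I J : countType) (X : T -> I) (Y : T -> J) (Q : I -> J -> Prop) :
  discrete_rv X -> discrete_rv Y -> measurable [set w | Q (X w) (Y w)].
Proof.
by move=> mX mY; exact: (discrete_rv_pair mX mY [set p | Q p.1 p.2]).
Qed.

End Discrete.

Lemma prod_half_power (R : realType) (I : Type) (s : seq I) (f : I -> \bar R) (g : I -> nat) :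
  (forall i, f i = ((2^-1) ^+ g i)%:E) ->
  (\prod_(i <- s) f i)%E = ((2^-1) ^+ (\sum_(i <- s) g i))%:E.
Proof.
move=> fg; elim: s => [|i s IH]; first by rewrite !big_nil.
by rewrite !big_cons IH fg -EFinM -exprD.
Qed.

Section CountableTools.
Context {d : measure_display} {T : measurableType d} {R : realType}.
Variable P : probability T R.

Lemma measurable_eq (A B : T -> Prop) : (forall w, A w <-> B w) ->
  measurable [set w | B w] -> measurable [set w | A w].
Proof. by move=> AB; rewrite (_ : [set w | A w] = [set w | B w])//; apply/seteqP; split=> w /AB. Qed.

Lemma measurable_exists2 (I : countType) (p : I -> Prop) (Q : I -> T -> Prop) :
  (forall i, measurable [set w | Q i w]) -> measurable [set w | exists2 i, p i & Q i w].
Proof.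
move=> mQ; apply: (@measurable_eq _ (fun w => exists i, p i /\ Q i w)).
  by move=> w; split=> [[i pi h]|[i [pi h]]]; exists i.
apply: measurable_exists => i; apply: measurable_and => //; exact: measurable_const.
Qed.

Lemma negligible_exists (I : countType) (F : I -> T -> Prop) :
  (forall i, P.-negligible [set w | F i w]) -> P.-negligible [set w | exists i, F i w].
Proof.
move=> nF.
pose G (n : nat) := [set w | if (choice.unpickle n : option I) is Some i then F i w else False].
have FG : [set w | exists i, F i w] `<=` \bigcup_n G n.
  by move=> w [i h]; exists (choice.pickle i) => //; rewrite /G /= choice.pickleK.
apply: negligibleS FG _; apply: negligible_bigcup => n; rewrite /G.
case: (choice.unpickle n) => [i|]; first exact: nF.
exact: negligible_set0.
Qed.

Lemma measure_exists_le (S : eqType) (s : seq S) (F : S -> set T) (e : R) :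
  (forall i, measurable (F i)) -> (forall i, (P (F i) <= e%:E)%E) ->
  measurable [set w | exists2 i, i \in s & F i w] /\
  (P [set w | exists2 i, i \in s & F i w] <= (e *+ size s)%:E)%E.
Proof.
move=> mF hF; elim: s => [|i s [mI IH]].
  rewrite (_ : [set w | _] = set0); last by apply/seteqP; split=> // w [].
  by rewrite measure0 mulr0n.
rewrite (_ : [set w | _] = F i `|` [set w | exists2 j, j \in s & F j w]); last first.
  apply/seteqP; split=> w.
    by move=> [j]; rewrite inE => /orP[/eqP -> ?|js h]; [left|right; exists j].
  by case=> [h|[j js h]]; [exists i; rewrite ?inE ?eqxx|exists j; rewrite ?inE ?js ?orbT].
split; first exact: measurableU.
apply: le_trans (measureU2 _ _ _) _ => //.
by rewrite /= mulrS EFinD leeD.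
Qed.

End CountableTools.

(** * Recurrence of the simple random walk *)

(** The words of [n] steps along which a walk started at [x > 0] stays
    positive; an up-step is [true]. *)
Fixpoint nohit (n x : nat) : seq (seq bool) :=
  if n is n'.+1 then
    [seq true :: l | l <- nohit n' x.+1] ++
    (if x is x'.+2 then [seq false :: l | l <- nohit n' x'.+1] else [::])
  else [:: [::]].

Lemma nohitP n (x : nat) (y : nat -> int) : (0 < x)%N -> y 0%N = 0 ->
  (forall k, y k.+1 = y k + 1 \/ y k.+1 = y k - 1) ->
  (forall k, 0 < x%:Z + y k) ->
  mkseq (fun k => y k.+1 == y k + 1) n \in nohit n x.
Proof.
elim: n x y => [|n IH] x y x0 y0 ys yp //.
rewrite /mkseq /= -[1%N]/(1 + 0)%N iotaDl -map_comp mem_cat.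
have sh k : y k.+2 - y 1%N = (y k.+1 - y 1%N) + 1 \/ y k.+2 - y 1%N = (y k.+1 - y 1%N) - 1.
  by case: (ys k.+1) => ->; [left|right]; lia.
have eqm : [seq ((fun k => y k.+1 == y k + 1) \o addn 1) i | i <- iota 0 n] =
    mkseq (fun k => y k.+2 - y 1%N == y k.+1 - y 1%N + 1) n.
  by apply: eq_map => k /=; rewrite add1n; apply/eqP/eqP; lia.
rewrite eqm; case: (ys 0%N) => e; rewrite e y0 in sh eqm *.
  rewrite eqxx; apply/orP; left; apply/mapP; eexists; last by reflexivity.
  apply: (IH x.+1 (fun k => y k.+1 - (0 + 1))) => //; first by rewrite e y0; lia.
  by move=> k; have := yp k.+1; lia.
rewrite (_ : (0 - 1 == 0 + 1 :> int) = false)//; apply/orP; right.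
case: x x0 yp => [|[|x]] // _ yp; first by have := yp 1%N; rewrite e y0.
apply/mapP; eexists; last by reflexivity.
apply: (IH x.+1 (fun k => y k.+1 - (0 - 1))) => //; first by rewrite e y0; lia.
by move=> k; have := yp k.+1; lia.
Qed.

Section NoHitProba.
Variable R : realType.

(** The probability that a simple random walk started at [x] stays positive
    for [n] steps. *)
Fixpoint pnohit (n x : nat) : R :=
  if x is x'.+1 then
    if n is n'.+1 then (pnohit n' x.+1 + pnohit n' x') / 2 else 1
  else 0.

Lemma pnohitS n x : pnohit n.+1 x.+1 = (pnohit n x.+2 + pnohit n x) / 2.
Proof. by []. Qed.

Lemma pnohitE n x : (size (nohit n x.+1))%:R / 2 ^+ n = pnohit n x.+1.
Proof.
elim: n x => [|n IH] x; first by rewrite /= expr0 divr1.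
rewrite [LHS]/= size_cat size_map natrD pnohitS -[pnohit n x.+2]IH.
set m := size (if x is x'.+1 then _ else _).
have -> : pnohit n x = m%:R / 2 ^+ n.
  rewrite /m; case: x {m} => [|x]; first by rewrite mul0r; case: (n).
  by rewrite size_map IH.
by rewrite exprS; field; rewrite expf_neq0.
Qed.

Lemma pnohit_ge0 n x : 0 <= pnohit n x.
Proof.
elim: n x => [|n IH] [|x] //=; rewrite ?ler01//.
by rewrite divr_ge0// addr_ge0.
Qed.

Lemma pnohit_le n x : pnohit n.+1 x <= pnohit n x.
Proof.
elim: n x => [|n IH] [|x].
- exact: lexx.
- by rewrite pnohitS; case: x => [|x] /=; lra.
- exact: lexx.
- by rewrite (pnohitS n.+1 x) (pnohitS n x); have := IH x.+2; have := IH x; lra.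
Qed.

Lemma pnohit_le1 n x : pnohit n x <= 1.
Proof.
elim: n => [|n IH]; first by case: x => [|x] /=; rewrite ?ler01 ?lexx.
by apply: le_trans IH; exact: pnohit_le.
Qed.

(** The limit [L] is harmonic on the positive integers and vanishes at 0, so
    [L x] is [x] times [L 1]. It is bounded, so it vanishes. *)
Lemma pnohit_small x (e : R) : 0 < e -> exists n, pnohit n x < e.
Proof.
move=> e0.
have cv y : cvgn (fun n => pnohit n y).
  apply: nonincreasing_is_cvgn; last by exists 0 => _ [n _ <-]; exact: pnohit_ge0.
  by apply/nonincreasing_seqP => n; exact: pnohit_le.
pose L y := limn (fun n => pnohit n y).
have Lc y : pnohit n y @[n --> \oo] --> L y by exact: cv.
have L0 : L 0%N = 0.
  rewrite /L (_ : (fun n => pnohit n 0) = cst 0); first exact: lim_cst.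
  by apply/funext => -[].
have Lr y : L y.+1 = (L y.+2 + L y) / 2.
  have h1 : pnohit n.+1 y.+1 @[n --> \oo] --> L y.+1.
    by have := Lc y.+1; rewrite -(cvg_shiftS (fun n => pnohit n y.+1)).
  have h2 : (fun n => (pnohit n y.+2 + pnohit n y) / 2) @ \oo --> (L y.+2 + L y) / 2.
    by apply: cvgM; [apply: cvgD; exact: Lc|exact: cvg_cst].
  by rewrite -(cvg_lim (@norm_hausdorff _ _) h1) -(cvg_lim (@norm_hausdorff _ _) h2).
have L1 y : L y <= 1.
  by apply: limr_le => //; apply: nearW => n; exact: pnohit_le1.
have Ly y : L y = y%:R * L 1%N /\ L y.+1 = y.+1%:R * L 1%N.
  elim: y => [|y [h1 h2]]; first by rewrite L0 mul0r mul1r.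
  split=> //; have := Lr y; rewrite h1 h2 => h.
  have {h} : L y.+2 = 2 * (y.+1%:R * L 1%N) - y%:R * L 1%N by rewrite h; field.
  move=> ->; rewrite -!natr1; ring.
have L10 : L 1%N <= 0.
  rewrite leNgt; apply/negP => l0.
  have [y hy] : exists y : nat, (L 1%N)^-1 < y%:R.
    by exists (Num.truncn (L 1%N)^-1).+1; exact: truncnS_gt.
  have := L1 y; rewrite (Ly y).1 leNgt => /negP; apply.
  by rewrite -ltr_pdivrMr// div1r.
have Lx : L x < e.
  by apply: le_lt_trans e0; rewrite (Ly x).1 mulr_ge0_le0.
have /cvgrPdist_lt/(_ (e - L x)) := Lc x; rewrite subr_gt0 => /(_ Lx)[n _ /(_ n)].
move=> /(_ (leqnn n)) /=; rewrite distrC => /(le_lt_trans (ler_norm _)).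
by rewrite ltrD2r => h; exists n.
Qed.

End NoHitProba.

Section WalkProba.
Context {d : measure_display} {Omega : measurableType d} {R : realType}.
Variables (P : probability Omega R) (b : int -> Omega -> int).
Hypothesis hb : two_sided_srw P b.

Let step i w := b (i + 1) w - b i w.

Let b_rv i : discrete_rv (b i).
Proof. by case: hb. Qed.

Let step_rv i : discrete_rv (step i).
Proof.
move=> B; exact: (discrete_rv_rel (fun x y => B (x - y)) (b_rv (i + 1)) (b_rv i)).
Qed.

Lemma steps_law (s : seq int) (a : int -> int) : uniq s ->
  (forall i, i \in s -> a i = 1 \/ a i = - 1) ->
  P [set w | forall i, i \in s -> step i w = a i] = ((2^-1) ^+ size s)%:E.
Proof.
move=> us ha; pose a' i : int := if a i == - 1 then - 1 else 1.
pose J := seq_fset tt s.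
have [_ _ law ind] := hb.
have := ind J (fun i => step i @^-1` [set a' i]) _.
move=> /(_ (fun i _ => ex_intro2 _ _ [set a' i] I erefl)).
have -> : \bigcap_(i in [set` J]) (step i @^-1` [set a' i]) =
    [set w | forall i, i \in s -> step i w = a i].
  apply/seteqP; split=> w h i.
    move=> is_; have /= -> := h i _; last by rewrite /= seq_fsetE.
    by rewrite /a'; case: (ha i is_) => ->.
  rewrite /= seq_fsetE => is_; rewrite h// /a'; by case: (ha i is_) => ->.
move=> ->; rewrite (@prod_half_power R _ _ _ (fun=> 1%N)).
  by rewrite sum1_size size_seq_fset undup_id.
move=> i; rewrite expr1 /a'; have [h1 h2] := law i; case: ifP => _; [exact: h2|exact: h1].
Qed.

Lemma steps_measurable (s : seq int) (a : int -> int) :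
  measurable [set w | forall i, i \in s -> step i w = a i].
Proof.
apply: measurable_forall => i; case: (boolP (i \in s)) => h.
  apply: (@measurable_eq _ _ _ (fun w => step i w = a i)); last exact: (step_rv i [set a i]).
  by move=> w; split=> [|-> //]; exact.
apply: (@measurable_eq _ _ _ (fun=> True)); last exact: measurable_const.
by move=> w; split.
Qed.

(** The path [y] is the walk seen from some time on, forwards or backwards:
    [e] enumerates the steps in this order, and [sg] is the sign they take. *)
Lemma nohit_negligible (e : nat -> int) (dd : int -> nat) (sg : int) (x : nat) :
  cancel e dd -> sg = 1 \/ sg = - 1 -> P.-negligible [set w | exists y : nat -> int,
    [/\ y 0%N = 0, forall k, y k.+1 - y k = sg * step (e k) w,
        forall k, y k.+1 = y k + 1 \/ y k.+1 = y k - 1 & forall k, 0 < x%:Z + y k]].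
Proof.
move=> ed hsg; case: x => [|x].
  rewrite (_ : [set w | _] = set0); first exact: negligible_set0.
  by apply/seteqP; split=> // w [y [y0 _ _ /(_ 0%N)]]; rewrite y0 addr0 ltxx.
pose s n := [seq e k | k <- iota 0 n].
have us n : uniq (s n) by rewrite map_inj_uniq ?iota_uniq//; exact: can_inj ed.
pose a (l : seq bool) i : int := if nth false l (dd i) then sg else - sg.
have ha l i : a l i = 1 \/ a l i = - 1.
  by rewrite /a; case: hsg => ->; case: ifP => _; rewrite ?opprK; [left|right|right|left].
pose U n := [set w | exists2 l, l \in nohit n x.+1 & forall i, i \in s n -> step i w = a l i].
have [mU hU] : (forall n, measurable (U n)) /\ (forall n, (P (U n) <= (pnohit R n x.+1)%:E)%E).
  suff h n : measurable (U n) /\ (P (U n) <= (pnohit R n x.+1)%:E)%E by split=> n; case: (h n).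
  have := @measure_exists_le _ _ _ P _ (nohit n x.+1)
    (fun l => [set w | forall i, i \in s n -> step i w = a l i]) (2^-1 ^+ n).
  move=> /(_ (fun l => steps_measurable _ _)); case.
    by move=> l; rewrite steps_law// size_map size_iota.
  move=> h1 h2; split=> //; apply: le_trans h2 _.
  by rewrite -pnohitE exprVn mulr_natl lexx.
exists (\bigcap_n U n); split.
- by apply: bigcap_measurable => //; exists 0%N.
- apply/eqP; rewrite eq_le measure_ge0 andbT.
  apply/lee_addgt0Pr => eps eps0; rewrite add0e.
  have [n hn] := pnohit_small x.+1 eps0.
  apply: le_trans (_ : P (U n) <= _)%E.
    apply: le_measure; rewrite ?inE//; first by apply: bigcap_measurable => //; exists 0%N.
    exact: bigcap_inf.
  by apply: le_trans (hU n) _; rewrite lee_fin ltW.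
move=> w [y [y0 ye ys yp]] n _; exists (mkseq (fun k => y k.+1 == y k + 1) n).
  exact: nohitP.
move=> i /mapP[k]; rewrite mem_iota add0n => /andP[_ kn] ->; rewrite /a ed nth_mkseq//.
have := ye k; case: (ys k) => ->; case: hsg => -> e1.
- rewrite eqxx; lia.
- rewrite eqxx; lia.
- rewrite ifF; [lia|apply/negbTE/eqP; lia].
- rewrite ifF; [lia|apply/negbTE/eqP; lia].
Qed.

Definition walk_osc : set Omega := [set w | oscillating (fun i => b i w)].

Lemma walk_osc_measurable : measurable walk_osc.
Proof.
apply: measurable_and.
  apply: measurable_forall => i.
  by apply: (discrete_rv_rel (fun x y => x = y + 1 \/ x = y - 1) (b_rv (i + 1)) (b_rv i)).
apply: measurable_forall => i; apply: measurable_forall => n; apply: measurable_and.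
  apply: measurable_exists2 => k; exact: (b_rv k [set v | v <= n]).
apply: measurable_exists2 => k; exact: (b_rv k [set v | v <= n]).
Qed.

(** A walk with steps 1 and -1 which does not oscillate stays above some level
    from some time on, in one of the two directions of time. *)
Lemma walk_osc_as : P walk_osc = 1%E.
Proof.
have [b0 _ law _] := hb.
suff h : P.-negligible (~` walk_osc).
  have h0 : P (~` walk_osc) = 0%E.
    by apply: measure_negligible => //; exact: measurableC walk_osc_measurable.
  rewrite -[walk_osc]setCK probability_setC ?h0 ?sube0//.
  exact: measurableC walk_osc_measurable.
pose Z := [set w | exists i, ~ (step i w = 1 \/ step i w = - 1)].
pose N (sg : int) (e : int -> nat -> int) := [set w | exists p : int * nat, exists y : nat -> int,
    [/\ y 0%N = 0, forall k, y k.+1 - y k = sg * step (e p.1 k) w,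
        forall k, y k.+1 = y k + 1 \/ y k.+1 = y k - 1 & forall k, 0 < p.2%:Z + y k]].
have nZ : P.-negligible Z.
  apply: negligible_exists => i.
  have [h1 h2] : P (step i @^-1` [set 1]) = (2^-1)%:E /\
    P (step i @^-1` [set - 1]) = (2^-1)%:E by exact: law.
  have m1 : measurable (step i @^-1` [set 1]) by exact: step_rv.
  have m2 : measurable (step i @^-1` [set - 1]) by exact: step_rv.
  have mm : measurable (step i @^-1` [set 1; - 1]) by exact: step_rv.
  rewrite (_ : [set w | _] = ~` (step i @^-1` [set 1; - 1])); last first.
    by apply/seteqP; split.
  have h0 : P (~` (step i @^-1` [set 1; - 1])) = 0%E.
    have eU : P (step i @^-1` [set 1; - 1]) =
        (P (step i @^-1` [set 1%R]) + P (step i @^-1` [set - 1]%R))%E.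
      rewrite preimage_setU; apply: measureU => //.
      by apply/seteqP; split=> // w [/= -> ].
    have e1 : 2^-1 + 2^-1 = 1 :> R by lra.
    by rewrite probability_setC// eU h1 h2 -EFinD e1 subrr.
  by apply/(negligibleP _ (measurableC mm)).
pose ef (i : int) (k : nat) : int := i + k%:Z.
pose eb (i : int) (k : nat) : int := i - k%:Z - 1.
have nf : P.-negligible (N 1 ef).
  apply: negligible_exists => -[i x]; apply: (@nohit_negligible (ef i) (fun j => absz (j - i)%R)).
    by move=> k; rewrite /ef; lia.
  by left.
have nb : P.-negligible (N (- 1) eb).
  apply: negligible_exists => -[i x]; apply: (@nohit_negligible (eb i) (fun j => absz (i - 1 - j)%R)).
    by move=> k; rewrite /eb; lia.
  by right.
apply: negligibleS (negligibleU (negligibleU nZ nf) nb) => w nosc.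
apply: contrapT => h; apply: nosc.
have {}h1 : ~ Z w by move=> z; apply: h; left; left.
have {}h2 : ~ N 1 ef w by move=> z; apply: h; left; right.
have {}h3 : ~ N (- 1) eb w by move=> z; apply: h; right.
have st i : b (i + 1) w = b i w + 1 \/ b (i + 1) w = b i w - 1.
  have : step i w = 1 \/ step i w = - 1.
    by apply: contrapT => hi; apply: h1; exists i.
  by rewrite /step => -[]; [left|right]; lia.
split=> // i n; split; apply: contrapT => hk.
- apply: h2; exists (i, absz (b i w - n)), (fun k => b (i + k%:Z) w - b i w).
  have low (k : nat) : n < b (i + k%:Z) w.
    by rewrite ltNge; apply/negP => le; apply: hk; exists (i + k%:Z) => //; lia.
  have low0 := low 0%N; rewrite addr0 in low0.
  have kE (k : nat) : i + k.+1%:Z = i + k%:Z + 1 by lia.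
  split=> /=; first by rewrite addr0 subrr.
  + by move=> k; rewrite kE /step /ef; ring.
  + by move=> k; rewrite kE; case: (st (i + k%:Z)) => ->; [left|right]; lia.
  + by move=> k; have := low k; lia.
- apply: h3; exists (i, absz (b i w - n)), (fun k => b (i - k%:Z) w - b i w).
  have low (k : nat) : n < b (i - k%:Z) w.
    by rewrite ltNge; apply/negP => le; apply: hk; exists (i - k%:Z) => //; lia.
  have low0 := low 0%N; rewrite subr0 in low0.
  have kE (k : nat) : i - k%:Z = i - k.+1%:Z + 1 by lia.
  have kE' (k : nat) : i - k%:Z - 1 = i - k.+1%:Z by lia.
  split=> /=; first by rewrite subr0 subrr.
  + by move=> k; rewrite /step /eb kE' -kE; ring.
  + by move=> k; rewrite [X in b X _ - _ + _]kE [X in b X _ - _ - _]kE; case: (st (i - k.+1%:Z)) => ->; [right|left]; lia.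
  + by move=> k; have := low k; lia.
Qed.

(** * Configurations of the simple random walk *)

Lemma reads_measurable f x : measurable [set w | reads (fun i => b i w) x f].
Proof.
elim: f x => [|c IHc s IHs] x /=; first exact: measurable_const.
apply: (@measurable_eq _ _ _ (fun w => (downstep (fun i => b i w) (x - 1) /\
  upstep (fun i => b i w) (left_end x c - 2)) /\ (reads (fun i => b i w) (x - 1) c /\
  reads (fun i => b i w) (left_end x c - 2) s))); first by move=> w; split=> [[]|[[? ?] []]].
apply: measurable_and; last exact: measurable_and.
apply: measurable_and.
  exact: (discrete_rv_rel (fun x y => is_true (x == y - 1)) (b_rv _) (b_rv _)).
exact: (discrete_rv_rel (fun x y => is_true (x == y + 1)) (b_rv _) (b_rv _)).
Qed.

Lemma walk_match_measurable c : measurable [set w | walk_match (fun i => b i w) c].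
Proof.
rewrite /walk_match; move: (- 1) 0 => s z; elim: (wconfig c) s z => [|[f g] c' IH] s z /=.
  exact: measurable_const.
set s' := s + 1 + _.
apply: (@measurable_eq _ _ _ (fun w => ((reads (fun i => b i w) s' g /\
  downstep (fun i => b i w) s') /\ (reads (fun i => b i w) z f /\
  upstep (fun i => b i w) (left_end z f - 1))) /\ wlevels (fun i => b i w) s' (left_end z f - 1) c')).
  by move=> w; split=> [[]|[[[? ?] [? ?]] ?]].
apply: measurable_and => //; apply: measurable_and; apply: measurable_and; try exact: reads_measurable.
  exact: (discrete_rv_rel (fun x y => is_true (x == y - 1)) (b_rv _) (b_rv _)).
exact: (discrete_rv_rel (fun x y => is_true (x == y + 1)) (b_rv _) (b_rv _)).
Qed.

(** All the steps of the interval from [left_time] to [right_time] are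
    prescribed. *)
Lemma walk_match_le c :
  (P [set w | walk_match (fun i => b i w) c] <= ((2^-1) ^+ (2 * config_size c))%:E)%E.
Proof.
have [[w0 h0]|h] := pselect (exists w, walk_match (fun i => b i w) c); last first.
  rewrite (_ : [set w | _] = set0); first by rewrite measure0 lee_fin exprn_ge0// invr_ge0.
  by apply/seteqP; split=> // w hw; apply: h; exists w.
(* The walks of the event have the same steps as [w0] on this interval. *)
pose s := [seq left_time 0 (wconfig c) + k%:Z | k <- iota 0 (2 * config_size c)].
have us : uniq s.
  by rewrite map_inj_uniq ?iota_uniq// => k k' /addrI [].
have ss w i : walk_match (fun i => b i w) c -> i \in s ->
    same_step (fun i => b i w) (fun i => b i w0) i.
  move=> hw /mapP[k]; rewrite mem_iota => hk ei; apply: (wlevels_same hw h0).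
  by have := time_span (wconfig c); rewrite config_size_wconfig ei; lia.
have := @steps_law s (fun i => step i w0) us _.
rewrite size_map size_iota => <-; last first.
  move=> i /(ss w0 i h0); rewrite /same_step /downstep /upstep /step.
  by case=> -[/eqP e _]; [right|left]; rewrite e; lia.
apply: le_measure; rewrite ?inE; [exact: walk_match_measurable|exact: steps_measurable|].
move=> w hw i is_; have := ss w i hw is_; rewrite /same_step /downstep /upstep /step.
by case=> -[/eqP e1 /eqP e2]; rewrite e1 e2; lia.
Qed.

Definition walk_in (H : set (seq nat -> nat)) : set Omega :=
  [set w | oscillating (fun i => b i w) /\ H (walk_tree (fun i => b i w))].

Definition config_of (r : nat) (H : set (seq nat -> nat)) (c : config) : Prop :=
  size c = r /\ exists2 k, H k & tree_match k [::] c.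

(** A configuration of height [r] determines whether the tree is in [H]. *)
Lemma walk_inE r H : depth_determined r H -> walk_in H =
  walk_osc `&` [set w | exists2 c, config_of r H c & walk_match (fun i => b i w) c].
Proof.
move=> dH; apply/seteqP; split=> w [bo hw]; split=> //.
  have [c [sc wc]] := walk_match_ex bo r; exists c => //; split=> //.
  by exists (walk_tree (fun i => b i w)) => //; exact: walk_match_tree_match.
have [c [sc [k Hk kc]] wc] := hw; apply: dH Hk; rewrite -sc.
apply: tree_match_depth kc _; exact: walk_match_tree_match.
Qed.

Lemma walk_in_measurable r H : depth_determined r H -> measurable (walk_in H).
Proof.
move=> dH; rewrite (walk_inE dH); apply: measurableI; first exact: walk_osc_measurable.
by apply: measurable_exists2 => c; exact: walk_match_measurable.
Qed.

End WalkProba.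

(** * Configurations of Kesten's tree *)

(** The relevant words form the tree cut at height [r], which is finite, and
    there are countably many finite lists of words with values. *)
Lemma depth_measurable (d : measure_display) (T : measurableType d)
  (K : T -> seq nat -> nat) r (H : set (seq nat -> nat)) :
  (forall u, discrete_rv (fun w => K w u)) -> depth_determined r H ->
  measurable [set w | H (K w)].
Proof.
move=> mK dH; pose Q (l : seq (seq nat * nat)) := exists2 k, H k &
  forall k', (forall p, p \in l -> k' p.1 = p.2) -> agree r k k'.
apply: (@measurable_eq _ _ _ (fun w => exists2 l, Q l &
    forall p, p \in l -> K w p.1 = p.2)) => [w|]; last first.
  apply: measurable_exists2 => l; apply: measurable_forall => p.
  case: (boolP (p \in l)) => preds.
    apply: (@measurable_eq _ _ _ (fun w => K w p.1 = p.2)); last exact: (mK p.1 [set p.2]).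
    by move=> w; split=> [|-> //]; exact.
  apply: (@measurable_eq _ _ _ (fun=> True)); last exact: measurable_const.
  by move=> w; split.
split=> [hw|[l [k Hk kl] hl]]; last by apply: dH Hk; exact: kl.
have /finite_seqP[s sE] := tree_fin r (K w).
exists [seq (u, K w u) | u <- s]; last by move=> _ /mapP[u _ ->].
exists (K w) => // k' hk' u ut ur; symmetry; apply: (hk' (u, K w u)).
apply: map_f; suff : [set` s] u by [].
by rewrite -sE /= in_tree_cut ut ltnW.
Qed.

Section Kesten.
Context {R : realType} {d : measure_display} {Omega : measurableType d}.
Variables (P : probability Omega R).
Variables (X : seq nat -> Omega -> nat) (S : nat -> Omega -> nat * nat).
Hypothesis hXS : kesten_variables P (@mu_half R) X S.

Definition kesten_children (w : Omega) : seq nat -> nat :=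
  kesten_offspring (fun u => X u w) (fun n => S n w).

Lemma kesten_rv u : discrete_rv (fun w => kesten_children w u).
Proof.
have mS n : discrete_rv (fun w => spine (fun n => (S n w).2) n).
  elim: n => [|n IH] B /=; first exact: measurable_const.
  exact: (discrete_rv_rel (fun p q => B (p.2 :: q)) (kesten_S_rv hXS n) IH).
move=> B.
exact: (discrete_rv_rel (fun p (q : (nat * nat) * nat) => B (if u == p then q.1.1 else q.2))
  (mS (size u)) (discrete_rv_pair (kesten_S_rv hXS (size u)) (kesten_X_rv hXS u))).
Qed.

Lemma kesten_in_measurable r H : depth_determined r H -> measurable [set w | H (kesten_children w)].
Proof. by apply: depth_measurable => u; exact: kesten_rv. Qed.

Definition kesten_match (c : config) : set Omega :=
  [set w | var_match (fun u => X u w) (fun n => S n w) [::] c].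

Lemma kforest_measurable u j f : measurable [set w | kforest (fun u => X u w) u j f].
Proof.
elim: f u j => [|c IHc s IHs] u j /=; first exact: measurable_const.
apply: (@measurable_eq _ _ _ (fun w => X (j :: u) w = nb_trees c /\
  (kforest (fun u => X u w) (j :: u) 0 c /\ kforest (fun u => X u w) u j.+1 s))).
  by move=> w; split=> [[]|[? []]].
apply: measurable_and; first exact: (kesten_X_rv hXS (j :: u) [set nb_trees c]).
exact: measurable_and.
Qed.

Lemma kesten_match_measurable c : measurable (kesten_match c).
Proof.
rewrite /kesten_match; elim: c [::] => [|[f g] c IH] u /=; first exact: measurable_const.
apply: (@measurable_eq _ _ _ (fun w => (S (size u) w = ((nb_trees f + nb_trees g).+1, nb_trees f) /\
  var_match (fun u => X u w) (fun n => S n w) (nb_trees f :: u) c) /\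
  (kforest (fun u => X u w) u 0 f /\ kforest (fun u => X u w) u (nb_trees f).+1 g))).
  by move=> w; split=> [[]|[[? ?] []]].
apply: measurable_and; apply: measurable_and => //; try exact: kforest_measurable.
exact: (kesten_S_rv hXS (size u) [set ((nb_trees f + nb_trees g).+1, nb_trees f)]).
Qed.

(** Each prescribed vertex with [n] children has weight [2^(-n-1)]: off the
    spine by definition, and on the spine because the size-bias [n] cancels
    with the uniform choice of the next spine vertex. The tree [k] serves to
    name the prescribed values. *)
Lemma kesten_match_ge c k : tree_match k [::] c ->
  (((2^-1) ^+ (2 * config_size c))%:E <= P (kesten_match c))%E.
Proof.
move=> kc.
pose A (i : seq nat + nat) : set Omega := match i with
  | inl u => X u @^-1` [set k u]
  | inr n => S n @^-1` [set spine_level (nth (FNil, FNil) c n)] end.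
pose g (i : seq nat + nat) : nat := match i with
  | inl u => (k u).+1 | inr n => ((spine_level (nth (FNil, FNil) c n)).1).+1 end.
pose s : seq (seq nat + nat) := map inl (cnodes [::] c) ++ map inr (iota 0 (size c)).
have us : uniq s.
  rewrite cat_uniq !map_inj_uniq; try by move=> ? ? [].
  rewrite cnodes_uniq iota_uniq andbT /=.
  by apply/hasPn => _ /mapP[n _ ->]; apply/negP => /mapP[].
have Ag i : P (A i) = ((2^-1) ^+ g i)%:E.
  case: i => [u|n] /=; first by rewrite (kesten_X_law hXS) /mu_half exprVn.
  rewrite /spine_level (kesten_S_law hXS) ltnS leq_addr /size_biased /mu_half exprVn.
  by rewrite mulrAC divff ?mul1r// pnatr_eq0.
have ind : P (\bigcap_(i in [set` seq_fset tt s]) A i) =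
    (\prod_(i <- seq_fset tt s) P (A i))%E.
  apply: (kesten_indep hXS) => -[u|n] _; first by exists [set k u].
  by exists [set spine_level (nth (FNil, FNil) c n)].
have e : (\sum_(i <- seq_fset tt s) g i = 2 * config_size c)%N.
  rewrite (perm_big s) /=; last first.
    by have := seq_fset_perm tt s; rewrite (undup_id us).
  rewrite big_cat !big_map /= -(cnodes_sum kc); congr (_ + _)%N.
  by rewrite [RHS](big_nth (FNil, FNil)) /index_iota subn0.
rewrite -e -(prod_half_power _ Ag) -ind; apply: le_measure; rewrite ?inE.
- apply: fin_bigcap_measurable; first exact: finite_fset.
  by move=> -[u|n] _; [exact: (kesten_X_rv hXS)|exact: (kesten_S_rv hXS)].
- exact: kesten_match_measurable.
move=> w hw; apply: (tree_match_var_match kc) => [u uc|n nc].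
  apply: (hw (inl u)); suff h : inl u \in seq_fset tt s by exact: h.
  by rewrite seq_fsetE mem_cat map_f.
apply: (hw (inr n)); suff h : inr n \in seq_fset tt s by exact: h.
rewrite seq_fsetE mem_cat; apply/orP; right.
by apply: map_f; rewrite mem_iota.
Qed.

Lemma kesten_match_sub c r H : depth_determined r H -> config_of r H c ->
  kesten_match c `<=` [set w | H (kesten_children w)].
Proof.
move=> dH [sc [k Hk kc]] w wc; apply: dH Hk; rewrite -sc.
by apply: tree_match_depth kc _; exact: var_match_tree_match.
Qed.

End Kesten.

(** * Equality of the laws *)

Section Sandwich.
Context {R : realType}.
Context {d : measure_display} {Omega : measurableType d} (P : probability Omega R).
Variable b : int -> Omega -> int.
Hypothesis hb : two_sided_srw P b.
Context {d' : measure_display} {Omega' : measurableType d'} (P' : probability Omega' R).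
Variables (X : seq nat -> Omega' -> nat) (S : nat -> Omega' -> nat * nat).
Hypothesis hXS : kesten_variables P' (@mu_half R) X S.

(** A walk whose tree is in [H] matches a configuration of [H], each of which
    is at most as likely for the walk as for Kesten's variables. These match
    at most one configuration, and if it is one of [H] then their tree is in
    [H]. *)
Lemma law_le r H : depth_determined r H ->
  (P (walk_in b H) <= P' [set w | H (kesten_children X S w)])%E.
Proof.
move=> dH.
pose F n := [set w | if (choice.pickle_inv n : option config) is Some c then
   config_of r H c /\ walk_match (fun i => b i w) c else False].
pose F' n := [set w | if (choice.pickle_inv n : option config) is Some c then
   config_of r H c /\ kesten_match X S c w else False].
have mF n : measurable (F n).
  rewrite /F; case: (choice.pickle_inv n) => [c|]; last exact: measurable_const.
  apply: measurable_and; [exact: measurable_const|exact: (walk_match_measurable hb)].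
have mF' n : measurable (F' n).
  rewrite /F'; case: (choice.pickle_inv n) => [c|]; last exact: measurable_const.
  apply: measurable_and; [exact: measurable_const|exact: (kesten_match_measurable hXS)].
apply: le_trans (_ : (P (\bigcup_n F n) <= _)%E).
  apply: le_measure; rewrite ?inE; first exact: (walk_in_measurable hb dH).
    exact: bigcupT_measurable.
  rewrite (walk_inE b dH) => w [_ hw]; have [c cH wc] := hw; exists (choice.pickle c) => //.
  by rewrite /F /= choice.pickleK_inv.
apply: le_trans (generalized_Boole_inequality P mF _) _; first exact: bigcupT_measurable.
apply: le_trans (_ : (\sum_(0 <= n <oo) P' (F' n) <= _)%E).
  apply: lee_nneseries => // n _; rewrite /F /F'.
  case: (choice.pickle_inv n) => [c|]; last first.
    by rewrite (_ : [set _ | False] = set0) ?measure0//; apply/seteqP; split.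
  have [hc|hc] := pselect (config_of r H c); last first.
    by rewrite (_ : [set w | _ /\ _] = set0) ?measure0//; apply/seteqP; split=> // w [].
  have [_ [k _ kc]] := hc.
  apply: le_trans (_ : ((2^-1) ^+ (2 * config_size c))%:E <= _)%E.
    rewrite (_ : [set w | _ /\ _] = [set w | walk_match (fun i => b i w) c]).
      exact: (walk_match_le hb).
    by apply/seteqP; split=> w; [case|move=> h; split].
  rewrite (_ : [set w | _ /\ _] = kesten_match X S c); first exact: (kesten_match_ge hXS kc).
  by apply/seteqP; split=> w; [case|move=> h; split].
rewrite -measure_semi_bigcup//; last exact: bigcupT_measurable.
  apply: le_measure; rewrite ?inE; first exact: bigcupT_measurable.
    exact: (kesten_in_measurable hXS dH).
  move=> w [n _]; rewrite /F'; case: (choice.pickle_inv n) => // c [cH wc].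
  exact: (kesten_match_sub dH cH).
apply/trivIsetP => i j _ _ ij; apply/seteqP; split=> // w [].
rewrite /F' /=; case ei : (choice.pickle_inv i) => [c|] // [[sc _] wc].
case ej : (choice.pickle_inv j) => [c'|] // [[sc' _] wc'].
have cc : c = c' by apply: (var_match_uniq wc wc'); rewrite sc.
have /eqP := ij; apply.
have pK (n : nat) (x : config) : choice.pickle_inv n = Some x -> n = choice.pickle x.
  by move=> e; have := choice.pickle_invK (T := config) n; rewrite e.
by rewrite (pK _ _ ei) (pK _ _ ej) cc.
Qed.

(** The opposite of [H] satisfies [law_le] too, and for both trees the
    probabilities of [H] and of its opposite add up to 1. *)
Lemma law_eq r H : depth_determined r H ->
  P (walk_in b H) = P' [set w | H (kesten_children X S w)].
Proof.
move=> dH; apply/eqP; rewrite eq_le (law_le dH).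
have dC : depth_determined r (~` H).
  by move=> k k' kk nH Hk; apply: nH; apply: dH Hk; exact: agree_sym.
have m1 := walk_in_measurable hb dH; have m2 := kesten_in_measurable hXS dH.
have mo := walk_osc_measurable hb; have mC := walk_in_measurable hb dC.
have o0 : P (~` walk_osc b) = 0%E by rewrite probability_setC// (walk_osc_as hb) subee.
(* The walks that do not oscillate have probability 0. *)
have h1 : (P (~` walk_in b H) <= P (walk_in b (~` H)))%E.
  rewrite -[leRHS]adde0 -o0; apply: le_trans (measureU2 P mC (measurableC mo)).
  apply: le_measure; rewrite ?inE; [exact: measurableC|by apply: measurableU => //; exact: measurableC|].
  move=> w nw; have [bo|bo] := pselect (oscillating (fun i => b i w)); last by right.
  by left; split=> // Hw; apply: nw.
have h2 : (P (walk_in b (~` H)) <= P' (~` [set w | H (kesten_children X S w)]))%E by exact: law_le dC.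
have := le_trans h1 h2; rewrite !probability_setC//.
have f1 : P (walk_in b H) \is a fin_num by exact: fin_num_measure.
have f2 : P' [set w | H (kesten_children X S w)] \is a fin_num by exact: fin_num_measure.
by rewrite -(fineK f1) -(fineK f2) -!EFinB !lee_fin; lra.
Qed.

End Sandwich.

Lemma dmap_open_setI (R : realType) : setI_closed (dmap_open R).
Proof.
move=> A B Ao Bo m [/Ao[e e0 he] /Bo[e' e'0 he']].
exists (Num.min e e'); first by rewrite lt_min e0.
by move=> m'; rewrite lt_min => /andP[h h']; split; [exact: he|exact: he'].
Qed.

Section OpenSets.
Context {R : realType}.
Context {d : measure_display} {Omega : measurableType d} (P : probability Omega R).
Variable b : int -> Omega -> int.
Hypothesis hb : two_sided_srw P b.
Context {d' : measure_display} {Omega' : measurableType d'} (P' : probability Omega' R).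
Variables (X : seq nat -> Omega' -> nat) (S : nat -> Omega' -> nat * nat).
Hypothesis hXS : kesten_variables P' (@mu_half R) X S.

Let U (w : Omega) : rmap := uihpq0 (fun i => b i w).
Let T (w : Omega') : rmap := kesten_tree (fun u => X u w) (fun n => S n w).

Variable A : set rmap.
Hypothesis Ao : dmap_open R A.

Let W := \bigcup_r walk_in b (ball_core A r).

Lemma walk_cores_measurable : measurable W.
Proof.
apply: bigcupT_measurable => r; apply: (walk_in_measurable hb (r := r)).
exact: ball_core_determined.
Qed.

Lemma walk_preimageE : U @^-1` A = W `|` (~` walk_osc b `&` [set w | A edge_map]).
Proof.
apply/seteqP; split=> w.
  rewrite /U /= => Aw; have [bo|bo] := pselect (oscillating (fun i => b i w)).
    have [r hr] := (open_ball_core _ Ao).1 ((uihpq0_open bo Ao).1 Aw).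
    by left; exists r.
  by right; split=> //; move: Aw; rewrite /uihpq0; case: asboolP.
case=> [[r _ [bo hr]]|[bo]]; last by rewrite /U /uihpq0 /=; case: asboolP.
by apply/(uihpq0_open bo Ao)/(open_ball_core _ Ao); exists r.
Qed.

Lemma walk_preimage_measurable : measurable (U @^-1` A).
Proof.
rewrite walk_preimageE; apply: measurableU; first exact: walk_cores_measurable.
apply: measurableI; last exact: measurable_const.
exact/measurableC/(walk_osc_measurable hb).
Qed.

Lemma kesten_preimageE :
  T @^-1` A = \bigcup_r [set w | ball_core A r (kesten_children X S w)].
Proof.
apply/seteqP; split=> w.
  by move=> /(open_ball_core _ Ao)[r hr]; exists r.
by move=> [r _ hr]; apply/(open_ball_core _ Ao); exists r.
Qed.

Let mK r : measurable [set w | ball_core A r (kesten_children X S w)].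
Proof. exact: (kesten_in_measurable hXS (@ball_core_determined A r)). Qed.

Lemma kesten_preimage_measurable : measurable (T @^-1` A).
Proof. by rewrite kesten_preimageE; exact: bigcupT_measurable. Qed.

(** Both probabilities are limits along the increasing union of
    [open_ball_core], with equal terms by [law_eq]. *)
Lemma preimage_law : P (U @^-1` A) = P' (T @^-1` A).
Proof.
have mW := walk_cores_measurable; have mo := walk_osc_measurable hb.
have -> : P (U @^-1` A) = P W.
  have m2 : measurable (~` walk_osc b `&` [set w | A edge_map]).
    by apply: measurableI; [exact: measurableC|exact: measurable_const].
  apply/eqP; rewrite walk_preimageE eq_le; apply/andP; split; last first.
    by apply: le_measure; rewrite ?inE//; exact: measurableU.
  apply: le_trans (measureU2 P mW m2) _.
  rewrite -[leRHS]adde0 leeD2l//.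
  have <- : P (~` walk_osc b) = 0%E by rewrite probability_setC// (walk_osc_as hb) subee.
  by apply: le_measure; rewrite ?inE//; exact: measurableC.
rewrite kesten_preimageE.
have mWr r : measurable (walk_in b (ball_core A r)).
  exact: (walk_in_measurable hb (@ball_core_determined A r)).
have c1 := @nondecreasing_cvg_mu _ _ _ P _ mWr mW.
have c2 := @nondecreasing_cvg_mu _ _ _ P' _ mK (bigcupT_measurable _ mK).
have nd1 : {homo (fun r => walk_in b (ball_core A r)) : n m / (n <= m)%N >-> (n <= m)%O}.
  move=> n m nm; apply/subsetPset => w [bo h]; split=> //; exact: ball_core_mono h.
have nd2 : {homo (fun r => [set w | ball_core A r (kesten_children X S w)]) :
    n m / (n <= m)%N >-> (n <= m)%O}.
  move=> n m nm; apply/subsetPset => w h; exact: ball_core_mono h.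
have {}c1 := c1 nd1; have {}c2 := c2 nd2.
have e : (P \o (fun r => walk_in b (ball_core A r))) =
    (P' \o (fun r => [set w | ball_core A r (kesten_children X S w)])).
  by apply/funext => r; exact: (law_eq hb hXS (@ball_core_determined A r)).
move: c1 c2; rewrite e => c1 c2.
exact: etrans (esym (cvg_lim (@ereal_hausdorff R) c1)) (cvg_lim (@ereal_hausdorff R) c2).
Qed.

End OpenSets.

Theorem proposition1 (R : realType)
  (d : measure_display) (Omega : measurableType d) (P : probability Omega R)
  (b : int -> Omega -> int) (hb : two_sided_srw P b)
  (d' : measure_display) (Omega' : measurableType d')
  (P' : probability Omega' R)
  (X : seq nat -> Omega' -> nat) (S : nat -> Omega' -> nat * nat)
  (hXS : kesten_variables P' (@mu_half R) X S) :
  let U : Omega -> map_space R := fun w => uihpq0 (fun i => b i w) in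
  let T : Omega' -> map_space R :=
    fun w => kesten_tree (fun u => X u w) (fun n => S n w) in
  [/\ measurable_fun [set: Omega] U,
      measurable_fun [set: Omega'] T
    & forall A : set (map_space R), measurable A ->
        pushforward P U A = pushforward P' T A].
Proof.
move=> U T.
have mU : measurable_fun [set: Omega] U.
  refine (@measurability _ _ _ (map_space R) _ U (dmap_open R) erefl _).
  by move=> _ [A Ao <-]; rewrite setTI; exact: (walk_preimage_measurable hb Ao).
have mT : measurable_fun [set: Omega'] T.
  refine (@measurability _ _ _ (map_space R) _ T (dmap_open R) erefl _).
  by move=> _ [A Ao <-]; rewrite setTI; exact: (kesten_preimage_measurable hXS Ao).
split=> // A mA.
pose mu1 := measure_function_pushforward__canonical__measure_function_Measure P mU.
pose mu2 := measure_function_pushforward__canonical__measure_function_Measure P' mT.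
have oT : dmap_open R setT by move=> m _; exists 1.
apply: (@measure_unique _ R (map_space R) (dmap_open R) (fun=> setT) _ _ _ _ mu1 mu2) => //.
- exact: dmap_open_setI.
- exact: bigcup_const.
- by move=> B Bo; exact: (preimage_law hb hXS Bo).
- by move=> k; rewrite /mu1 /= /pushforward preimage_setT probability_setT ltry.
Qed.
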